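(* Let $q\ge 4$ be a power of $2$, let $D$ be a derivation set on the line at infinity $\ell_\infty$ of $\mathrm{AG}(2,q^2)$, and let $K$ be a parabola with infinite point $I$ and nucleus $N$. Assume that $I\notin D$ and $N\notin D$. Then the following hold. (i) Each line of the Hall plane $\mathrm{Hall}(q^2)$ intersects $K$ in $0$, $1$, $2$ or $4$ (affine) points. (ii) If $I$ and $N$ are conjugate with respect to $D$, and $q$ is not a square, then each affine point $P\in K$ is contained in exactly $(q+1)/3$ new lines that are $4$-secant to $K$ and exactly $2(q+1)/3$ new lines that are $1$-secant to $K$. In particular, the Hall plane has no $2$-secant new lines to $K$.
   Context: $\mathrm{AG}(2,q^2)=\mathrm{PG}(2,q^2)\setminus\ell_\infty$. A derivation set $D$ is a Baer subline of $\ell_\infty$, i.e. an image under a projectivity of $\ell_\infty$ of the standard one $\{(x:y:0)\mid x,y\in\mathrm{GF}(q),\ (x,y)\neq(0,0)\}$ (where $\ell_\infty: Z=0$). The affine Hall plane $\mathrm{Hall}(q^2)$ obtained from $D$ has as points the points of $\mathrm{AG}(2,q^2)$; its lines are the ''old lines'', i.e. the affine parts of the lines of $\mathrm{PG}(2,q^2)$ other than $\ell_\infty$ whose infinite point is not in $D$, and the ''new lines'', i.e. the affine parts $B\setminus\ell_\infty$ of the Baer subplanes $B$ (subplanes of order $q$) of $\mathrm{PG}(2,q^2)$ containing $D$. For the standard $D$ the new lines are the sets $\{(a+\lambda u,b+\lambda v): u,v\in\mathrm{GF}(q)\}$ with $a,b\in\mathrm{GF}(q^2)$, $\lambda\in\mathrm{GF}(q^2)^*$.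 Conic means irreducible conic. A parabola is a conic of $\mathrm{PG}(2,q^2)$ having exactly one point on $\ell_\infty$ (its infinite point). In even characteristic all tangents of a conic pass through one common point, the nucleus; since $\ell_\infty$ is tangent to a parabola, its nucleus lies on $\ell_\infty$. A line is an $i$-secant of $K$ if it meets $K$ in exactly $i$ affine points. Two points of $\ell_\infty\setminus D$ are conjugate with respect to $D$ if they are interchanged by the involution of $\ell_\infty$ that fixes exactly the points of $D$ and is induced by the Frobenius $x\mapsto x^q$ in a coordinate frame where $D$ is standard, i.e. $(x:y:0)\mapsto(x^q:y^q:0)$. *)

(* Defs.v *)
From HB Require Import structures.
From mathcomp Require Import all_boot all_order all_algebra.
From mathcomp.multinomials Require Import mpoly.

Set Implicit Arguments.
Unset Strict Implicit.
Unset Printing Implicit Defensive.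

Import GRing.Theory.
Local Open Scope ring_scope.

(* Points of PG(2,F) are the one-dimensional subspaces of F^3, each given as
   the set of its vectors. *)

Definition ray (F : finFieldType) (v : 'rV[F]_3) : {set 'rV[F]_3} :=
  [set a *: v | a : F].

Definition is_ray (F : finFieldType) (p : {set 'rV[F]_3}) : bool :=
  [exists v : 'rV[F]_3, (v != 0) && (p == ray v)].

Record point (F : finFieldType) :=
  Point { point_set : {set 'rV[F]_3}; _ : is_ray point_set }.
HB.instance Definition _ (F : finFieldType) := [isSub for @point_set F].
HB.instance Definition _ (F : finFieldType) := [Finite of point F by <:].

Fact pt_subproof (F : finFieldType) (v : 'rV[F]_3) :
  is_ray (ray (if v == 0 then const_mx 1 else v)).
Proof.
apply/existsP; exists (if v == 0 then const_mx 1 else v); rewrite eqxx andbT.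
case: ifP => [_|->//]; apply/eqP => /rowP/(_ ord0); rewrite !mxE.
exact/eqP/oner_neq0.
Qed.

(* The point with homogeneous coordinates v.  For v = 0 the value is junk;
   pt is only ever used together with v != 0. *)
Definition pt (F : finFieldType) (v : 'rV[F]_3) : point F :=
  Point (pt_subproof v).

Definition line (F : finFieldType) (a : 'cV[F]_3) : {set point F} :=
  [set pt v | v : 'rV[F]_3 & (v != 0) && (v *m a == 0)].

Definition lines (F : finFieldType) : {set {set point F}} :=
  [set line a | a : 'cV[F]_3 & a != 0].

(* Z = 0 *)
Definition linf (F : finFieldType) : {set point F} := line (delta_mx ord_max 0).

(* The point (x : y : 0), for w = (x, y) != 0. *)
Definition ptinf (F : finFieldType) (w : 'rV[F]_2) : point F :=
  pt (row_mx w (0 : 'rV[F]_1)).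

(* The elements of F with x ^+ q = x form the subfield GF(q) of
   F = GF(q^2). *)
Definition subvec (F : finFieldType) (q : nat) : {set 'rV[F]_2} :=
  [set w : 'rV[F]_2 | (w != 0) && [forall j, w 0 j ^+ q == w 0 j]].

(* The image of the standard Baer subline {(x : y : 0) | x, y in GF(q)} under
   the projectivity of linf with matrix M. *)
Definition subline_of (F : finFieldType) (q : nat) (M : 'M[F]_2) :
    {set point F} :=
  [set ptinf (w *m M) | w in subvec F q].

Definition derivation_set (F : finFieldType) (q : nat) (D : {set point F}) :
    Prop :=
  exists2 M : 'M[F]_2, M \in unitmx & D = subline_of q M.

(* P is mapped to Q by (x : y : 0) |-> (x^q : y^q : 0), read in the coordinate
   frame of linf given by M. *)
Definition frob_inf (F : finFieldType) (q : nat) (M : 'M[F]_2)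
    (P Q : point F) : Prop :=
  exists w : 'rV[F]_2, [/\ w != 0, P = ptinf (w *m M)
    & Q = ptinf (map_mx (fun x => x ^+ q) w *m M)].

Definition conjugate_pts (F : finFieldType) (q : nat) (D : {set point F})
    (P Q : point F) : Prop :=
  [/\ P \in linf F :\: D, Q \in linf F :\: D
    & exists M : 'M[F]_2, [/\ M \in unitmx, D = subline_of q M,
        frob_inf q M P Q & frob_inf q M Q P]].

(* Subplanes of order q: the points of B, with the lines joining two of them
   as lines, form a projective plane of order q. *)
Definition subplane (F : finFieldType) (q : nat) (B : {set point F}) : bool :=
  [&& [exists S : {set point F},
         [&& S \subset B, #|S| == 4%N
           & [forall l in lines F, (#|l :&: S| <= 2)%N]]],
      [forall l in lines F, forall m in lines F,
         [&& l != m, (2 <= #|l :&: B|)%N & (2 <= #|m :&: B|)%N]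
           ==> (l :&: m \subset B)]
    & [forall l in lines F, (2 <= #|l :&: B|)%N ==> (#|l :&: B| == q.+1)]].

Definition old_lines (F : finFieldType) (D : {set point F}) :
    {set {set point F}} :=
  [set l :\: linf F | l in lines F & (l != linf F) && [disjoint l & D]].

Definition new_lines (F : finFieldType) (q : nat) (D : {set point F}) :
    {set {set point F}} :=
  [set B :\: linf F | B : {set point F} & subplane q B && (D \subset B)].

Definition hall_lines (F : finFieldType) (q : nat) (D : {set point F}) :
    {set {set point F}} :=
  old_lines D :|: new_lines q D.

Definition abs_irreducible (F : fieldType) (n : nat) (Q : {mpoly F[n]}) : Prop :=
  (1 < msize Q)%N /\
  forall (L : fieldType) (iota : {rmorphism F -> L}) (f g : {mpoly L[n]}),
    map_mpoly iota Q = f * g -> (msize f <= 1)%N \/ (msize g <= 1)%N.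

(* An irreducible conic is the zero locus of an absolutely irreducible
   quadratic form; this excludes a pair of conjugate imaginary lines, whose
   form is irreducible over F only. *)
Definition conic (F : finFieldType) (K : {set point F}) : Prop :=
  exists Q : {mpoly F[3]}, [/\ Q \is 2.-homog, abs_irreducible Q
    & K = [set pt v | v : 'rV[F]_3 & (v != 0) && (Q.@[v 0] == 0)]].

Definition parabola (F : finFieldType) (K : {set point F}) (I : point F) : Prop :=
  conic K /\ K :&: linf F = [set I].

Definition tangents (F : finFieldType) (K : {set point F}) : {set {set point F}} :=
  [set l in lines F | #|l :&: K| == 1%N].

Definition nucleus (F : finFieldType) (K : {set point F}) (N : point F) : Prop :=
  forall l, l \in tangents K -> N \in l.

(* Meant for affine lines L (subsets of the complement of linf), so that only
   affine points of K are counted. *)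
Definition secant (F : finFieldType) (i : nat) (K L : {set point F}) : bool :=
  #|L :&: K| == i.

(* Main.v *)
Require Import Defs.
From mathcomp Require Import all_boot all_order all_algebra.
From mathcomp Require Import all_fingroup all_solvable all_field.
From mathcomp.multinomials Require Import mpoly.
From mathcomp Require Import ring zify.

Set Implicit Arguments.
Unset Strict Implicit.
Unset Printing Implicit Defensive.

Import GRing.Theory.
Local Open Scope ring_scope.

(** The argument works with explicit coordinates over F = GF(q^2), where
    q = 2^h; sigma denotes the involution x |-> x^q, whose fixed field is GF(q).
    Affine points are [aff x] and infinite points [ptinf d] for x, d in F^2.

    In characteristic 2 a binary quadratic form with exactly one projective zero
    is the square of a linear form.  Hence the affine points of a parabola are
    the solutions x of A(x)^2 + B(x) + c = 0 with A and B linear; I is the zero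
    of A, the tangents all have the direction that kills B, so N is the zero of
    B, and A and B are independent because the conic would otherwise split into
    two lines ([parabola_affine]).  On an old line the equation is quadratic in
    one parameter, which leaves at most two points ([old_line_secant]).

    If M maps the standard Baer subline to D, then the new lines are the sets
    p + lam GF(q)^2 M with lam != 0: that these sets are affine parts of Baer
    subplanes is [new_line_in], and that there are no others is
    [new_line_of_subplane].  A new line through a point p of K meets K in the
    points p + lam w M with w in GF(q)^2 and lam A(wM)^2 + B(wM) = 0.  These w
    form an elementary abelian 2-group.  Since I is not in D, the form A(wM) has
    no zero on GF(q)^2 except w = 0, so it is injective there and
    B(wM) = mu z + nu z^q for z = A(wM) and suitable constants mu and nu.
    Applying sigma to the equation and eliminating z^q leaves a polynomial in z
    of degree 4, so the group has order 1, 2 or 4 ([card_sols]).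

    If I and N are conjugate, then B(wM) = kap z^q ([conjugate_form]), and the
    equation for z != 0 becomes lam z^2 = kap z^q.  When q is not a square,
    q = 2 modulo 3, so the solutions are permuted by the cube roots of unity,
    which lie in F; a group of order 2 is therefore impossible ([sols_not2]).
    Each nonzero w solves the equation for exactly one lam, and lam, lam' give
    the same line through p exactly if lam' / lam is in GF(q).  Counting the
    q^2 - 1 nonzero w gives (q^2 - 1)/3 scalars with 4 solutions, that is
    (q + 1)/3 lines, out of the q + 1 new lines through p
    ([conjugate_count]). *)

(** * Kernels, independence and invertible matrices *)

Section Kernels.

Variable F : fieldType.

(** The row kernel of X is one-dimensional.  With its transpose, this yields the
    uniqueness of joins and meets: two points span one line, two lines meet in
    one point, a linear form on a plane has one projective zero. *)
Lemma ker_line m n (X : 'M[F]_(n, m)) (v w : 'rV_n) :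
  \rank X = n.-1 -> v != 0 -> v *m X = 0 -> w *m X = 0 ->
  exists c, w = c *: v.
Proof.
move=> rX vN0 /sub_kermxP vX /sub_kermxP wX; apply/sub_rVP.
have rk : (\rank (kermx X) <= \rank v)%N.
  by rewrite mxrank_ker rX rank_rV vN0; case: (n) => // k; rewrite subSnn.
by rewrite (submx_trans wX) // -(geq_leqif (mxrank_leqif_sup vX)).
Qed.

Lemma coker_line m n (X : 'M[F]_(m, n)) (a b : 'cV_n) :
  \rank X = n.-1 -> a != 0 -> X *m a = 0 -> X *m b = 0 ->
  exists c, b = c *: a.
Proof.
rewrite -mxrank_tr -(inj_eq trmx_inj) trmx0 => rX aN0 Xa Xb.
have [||c e] := ker_line (w := b^T) rX aN0; rewrite -?trmx_mul ?Xa ?Xb ?trmx0 //.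
by exists c; apply: trmx_inj; rewrite e linearZ.
Qed.

Lemma rank_pair n (u v : 'rV[F]_n) :
  (forall s t : F, s *: u + t *: v = 0 -> s = 0 /\ t = 0) ->
  \rank (col_mx u v) = 2%N.
Proof.
move=> ind; apply/eqP; rewrite -[_ == _]/(row_free (col_mx u v)).
rewrite -kermx_eq0; apply/rowV0P=> w /sub_kermxP.
rewrite -[w]hsubmxK mul_row_col [lsubmx w]mx11_scalar [rsubmx w]mx11_scalar.
by rewrite !mul_scalar_mx => /ind[-> ->]; rewrite !raddf0 row_mx0.
Qed.

Lemma mulmx_unit_eq0 m n (A : 'M[F]_(m, n)) (G : 'M_n) :
  G \in unitmx -> (A *m G == 0) = (A == 0).
Proof.
move=> uG; apply/eqP/eqP=> [e|->]; last by rewrite mul0mx.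
by rewrite -[A](mulmxK uG) e mul0mx.
Qed.

Lemma unit_mulmx_eq0 m n (A : 'M[F]_(n, m)) (G : 'M_n) :
  G \in unitmx -> (G *m A == 0) = (A == 0).
Proof.
move=> uG; apply/eqP/eqP=> [e|->]; last by rewrite mulmx0.
by rewrite -[A](mulKmx uG) e mulmx0.
Qed.

Lemma nonproportional_indep (V : lmodType F) (u v : V) :
  v != 0 -> (forall c, u <> c *: v) ->
  forall s t : F, s *: u + t *: v = 0 -> s = 0 /\ t = 0.
Proof.
move=> vN0 uv s t e; have s0 : s = 0.
  apply/eqP; apply: contraT => sN0; case: (uv (- (t / s))); apply: (scalerI sN0).
  rewrite scalerA mulrN mulrCA mulfV // mulr1 scaleNr.
  by apply/eqP; rewrite -addr_eq0 e.
split=> //; move/eqP: e.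
by rewrite s0 scale0r add0r scaler_eq0 (negPf vN0) orbF => /eqP.
Qed.

Lemma rank_col n (a : 'cV[F]_n) : a != 0 -> \rank a = 1%N.
Proof. by move=> aN0; rewrite -mxrank_tr rank_rV -(inj_eq trmx_inj) trmxK trmx0 aN0.
  Qed.

End Kernels.

(** * Points and lines of PG(2,F) in affine coordinates *)

Section Points.

Variable F : finFieldType.
Implicit Types (v w : 'rV[F]_3) (x y d : 'rV[F]_2) (P : point F).

Lemma pt_val v : v != 0 -> point_set (pt v) = ray v.
Proof. by move=> vN0; rewrite /pt /= (negPf vN0). Qed.

Lemma ray_scale (c : F) v : c != 0 -> ray (c *: v) = ray v.
Proof.
move=> cN0; apply/setP=> u; apply/imsetP/imsetP=> -[b _ ->].
  by exists (b * c); rewrite ?scalerA.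
by exists (b / c); rewrite // scalerA mulfVK.
Qed.

Lemma pt_scale (c : F) v : c != 0 -> pt (c *: v) = pt v.
Proof.
move=> cN0; have [->|vN0] := eqVneq v 0; first by rewrite scaler0.
by apply: val_inj; rewrite [LHS]pt_val ?scaler_eq0 ?negb_or ?cN0 // [RHS]pt_val
  ?ray_scale.
Qed.

Lemma pt_row_scale (c : F) x (z : 'rV[F]_1) : c != 0 ->
  pt (row_mx (c *: x) (c *: z)) = pt (row_mx x z).
Proof. by move=> cN0; rewrite -scale_row_mx; apply: pt_scale. Qed.

Lemma pt_inj v w : v != 0 -> w != 0 -> pt v = pt w ->
  exists2 c, c != 0 & v = c *: w.
Proof.
move=> vN0 wN0 e; have : v \in ray w.
  rewrite -pt_val // -e pt_val //.
  by apply/imsetP; exists 1; rewrite ?scale1r.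
case/imsetP=> c _ def_v; exists c => //.
by apply: contraNneq vN0 => c0; rewrite def_v c0 scale0r.
Qed.

Lemma pt_mulmx_inj (G : 'M[F]_3) v w : G \in unitmx -> v != 0 -> w != 0 ->
  pt (v *m G) = pt (w *m G) -> exists2 c, c != 0 & v = c *: w.
Proof.
move=> uG vN0 wN0 /pt_inj[||c cN0 e]; rewrite ?mulmx_unit_eq0 //.
exists c => //; apply/eqP.
by rewrite -subr_eq0 -(mulmx_unit_eq0 _ uG) mulmxBl e -scalemxAl subrr.
Qed.

Lemma pt_row_inj x y (z t : 'rV[F]_1) : row_mx x z != 0 -> row_mx y t != 0 ->
  pt (row_mx x z) = pt (row_mx y t) -> exists c, [/\ c != 0, x = c *: y & z = c *: t].
Proof.
move=> n1 n2 /(pt_inj n1 n2)[c cN0 e]; exists c.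
have {}e : row_mx x z = row_mx (c *: y) (c *: t) by rewrite e -scale_row_mx.
by have [] := eq_row_mx e.
Qed.

Lemma pt_surj P : exists2 v, v != 0 & P = pt v.
Proof.
case: P => A hA; have /existsP[v /andP[vN0 /eqP eA]] := hA.
by exists v => //; apply: val_inj; rewrite /= (negPf vN0).
Qed.

Lemma mem_line (a : 'cV[F]_3) v : v != 0 -> (pt v \in line a) = (v *m a == 0).
Proof.
move=> vN0; apply/imsetP/idP=> [[w]|va]; last by exists v; rewrite ?inE ?vN0.
rewrite inE => /andP[wN0 /eqP wa] /(pt_inj vN0 wN0)[c _ ->].
by rewrite -scalemxAl wa scaler0.
Qed.

Definition aff x : point F := pt (row_mx x 1%:M).

Lemma row_aff_neq0 x : row_mx x (1%:M : 'M[F]_1) != 0.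
Proof.
apply/eqP=> e; have : row_mx x (1%:M : 'M[F]_1) = row_mx 0 0 by rewrite e row_mx0.
by case/eq_row_mx=> _ /matrixP/(_ 0 0)/eqP; rewrite !mxE oner_eq0.
Qed.

Lemma row_inf_neq0 d : (row_mx d (0 : 'rV[F]_1) != 0) = (d != 0).
Proof.
congr (~~ _); apply/eqP/eqP=> [e|->]; last exact: row_mx0.
have : row_mx d (0 : 'rV[F]_1) = row_mx 0 0 by rewrite e row_mx0.
by case/eq_row_mx.
Qed.

Lemma point_cases P :
  (exists2 d, d != 0 & P = ptinf d) \/ (exists x, P = aff x).
Proof.
have [v vN0 ->] := pt_surj P.
pose u : 'rV[F]_(2 + 1) := v; have ev : v = row_mx (lsubmx u) (rsubmx u).
  by rewrite hsubmxK.
rewrite {}ev in vN0 *; move: (lsubmx u) (rsubmx u) vN0 => x z {u v}.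
rewrite [z]mx11_scalar; have [->|zN0] := eqVneq (z 0 0) 0.
  by rewrite raddf0 row_inf_neq0; left; exists x.
move=> _; right; exists ((z 0 0)^-1 *: x).
rewrite /aff -(@pt_row_scale (z 0 0)^-1 x) ?invr_eq0 //.
by rewrite scale_scalar_mx mulVf.
Qed.

Lemma aff_inj : injective aff.
Proof.
move=> x y /(pt_row_inj (row_aff_neq0 _) (row_aff_neq0 _))[c [_ -> /matrixP/(_ 0 0)]].
by rewrite !mxE mulr1 => <-; rewrite scale1r.
Qed.

Lemma ptinf_scale (c : F) d : c != 0 -> ptinf (c *: d) = ptinf d.
Proof.
by move=> cN0; rewrite /ptinf -(@pt_row_scale c d) // scaler0.
Qed.

Lemma ptinf_inj x d : x != 0 -> d != 0 -> ptinf x = ptinf d ->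
  exists2 c, c != 0 & x = c *: d.
Proof.
rewrite -!row_inf_neq0 => xN0 dN0 /(pt_row_inj xN0 dN0)[c [cN0 -> _]].
by exists c.
Qed.

Lemma line_split (l : 'cV[F]_3) : exists a (c : 'cV[F]_1), l = col_mx (a : 'cV[F]_2) c.
Proof. by exists (usubmx (l : 'cV_(2 + 1))), (dsubmx (l : 'cV_(2+1)));
  rewrite vsubmxK. Qed.

Lemma aff_in_line (a : 'cV[F]_2) c x :
  (aff x \in line (col_mx a c)) = (x *m a + c == 0).
Proof. by rewrite mem_line ?row_aff_neq0 // -[c in RHS]mul1mx -(mul_row_col x). Qed.

Lemma ptinf_in_line (a : 'cV[F]_2) (c : 'cV_1) d : d != 0 ->
  (ptinf d \in line (col_mx a c)) = (d *m a == 0).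
Proof.
move=> dN0; rewrite mem_line ?row_inf_neq0 // -[in RHS](addr0 (d *m a)).
by rewrite -[X in _ = (_ + X == _)](mul0mx _ c) -(mul_row_col d).
Qed.

Lemma linfE : linf F = line (col_mx (0 : 'cV[F]_2) (1%:M : 'cV[F]_1)).
Proof.
congr line; apply/matrixP=> i j; rewrite !mxE eq_sym ord1 eqxx andbT.
case: splitP => k /= ek; rewrite !mxE -val_eqE /= ek; last by rewrite !ord1.
by rewrite gtn_eqF.
Qed.

Lemma ptinf_linf d : d != 0 -> ptinf d \in linf F.
Proof. by move=> dN0; rewrite linfE ptinf_in_line // mulmx0. Qed.

Lemma aff_linf x : aff x \notin linf F.
Proof.
rewrite linfE aff_in_line mulmx0 add0r.
by apply/eqP => /matrixP/(_ 0 0)/eqP; rewrite !mxE oner_eq0.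
Qed.

Lemma line_in (l : 'cV[F]_3) : l != 0 -> line l \in lines F.
Proof. by move=> lN0; apply: imset_f; rewrite inE. Qed.

Lemma linf_in : linf F \in lines F.
Proof.
by apply: line_in; apply/eqP=> /matrixP/(_ ord_max 0)/eqP; rewrite !mxE !eqxx oner_eq0.
Qed.

(** Translates cardinalities and equalities of affine point sets into statements
    about vectors of F^2. *)
Lemma affine_part (A : {set point F}) :
  A :\: linf F = aff @: [set x | aff x \in A].
Proof.
apply/setP=> P; rewrite inE; apply/idP/imsetP=> [/andP[PN PA]|[x]].
  case: (point_cases P) => [[d dN0 eP]|[x eP]]; last first.
    by exists x => //; rewrite inE -eP.
  by rewrite eP ptinf_linf in PN.
by rewrite inE => xA ->; rewrite aff_linf.
Qed.

(** The linear form vanishing at d, as a column; it serves as the normal vector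
    of the lines with direction d. *)
Definition perp d : 'cV[F]_2 := \col_i (if i == 0 then d 0 1 else - d 0 0).

Lemma mul_perp x d : x *m perp d = (x 0 0 * d 0 1 - x 0 1 * d 0 0)%:M.
Proof.
apply/matrixP=> i j; rewrite !ord1 !mxE eqxx mulr1n big_ord_recl big_ord1 !mxE /=.
have -> : lift ord0 ord0 = 1 :> 'I_2 by apply: val_inj.
by rewrite mulrN.
Qed.

Lemma perp_neq0 d : (perp d != 0) = (d != 0).
Proof.
congr (~~ _); apply/eqP/eqP => [e|->]; last by apply/matrixP=> i j;
  rewrite !mxE oppr0 if_same.
have := congr1 (fun a : 'cV[F]_2 => a 0 0) e.
have := congr1 (fun a : 'cV[F]_2 => a 1 0) e; rewrite !mxE /= => /eqP.
rewrite oppr_eq0 => /eqP d0 d1; apply/rowP=> i; rewrite mxE.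
case: (unliftP 0 i) => [k ->|-> //]; rewrite ord1 -[RHS]d1.
by congr (d _ _); apply: val_inj.
Qed.

Lemma perp_ker x d : d != 0 -> x *m perp d = 0 -> exists c, x = c *: d.
Proof.
move=> dN0; apply: ker_line => //; first by rewrite rank_col ?perp_neq0.
by rewrite mul_perp mulrC subrr raddf0.
Qed.

(** The line through [aff x] with infinite point [ptinf d]. *)
Definition affine_line x d : {set point F} := line (col_mx (perp d) (- (x *m perp d))).

Lemma affine_line_in x d : d != 0 -> affine_line x d \in lines F.
Proof.
move=> dN0; apply: line_in; apply: contraNneq dN0 => e.
have {}e : col_mx (perp d) (- (x *m perp d)) = col_mx 0 0 by rewrite e col_mx0.
by have [/eqP] := eq_col_mx e; rewrite -[_ == _]negbK perp_neq0 => /negbNE.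
Qed.

Lemma aff_in_affine_line y x d : d != 0 ->
  reflect (exists t, y = x + t *: d) (aff y \in affine_line x d).
Proof.
move=> dN0; rewrite aff_in_line -mulmxBl;
  apply: (iffP eqP) => [/(perp_ker dN0)[t e]|[t ->]].
  by exists t; rewrite -e addrC subrK.
by rewrite addrC addKr -scalemxAl mul_perp mulrC subrr raddf0 scaler0.
Qed.

Lemma ptinf_in_affine_line e x d : d != 0 -> e != 0 ->
  reflect (exists t, e = t *: d) (ptinf e \in affine_line x d).
Proof.
move=> dN0 eN0; rewrite ptinf_in_line //;
  apply: (iffP eqP) => [/(perp_ker dN0)//|[t ->]].
by rewrite -scalemxAl mul_perp mulrC subrr raddf0 scaler0.
Qed.

End Points.

(** * The Frobenius involution and its fixed field *)

(** The exponent is odd, and 2 * 4^k = 2 modulo 3. *)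
Lemma pow2_nonsquare_mod3 h :
  ~ (exists m : nat, 2 ^ h = m ^ 2)%N -> (2 ^ h %% 3 = 2)%N.
Proof.
rewrite -(odd_double_half h); case: (odd h) => [_|[]].
  rewrite add1n expnS -mul2n expnM -[(2 ^ 2)%N]/4%N; elim: (h./2) => // k.
  by rewrite (expnS 4 k); move: (4 ^ k)%N => m; lia.
by exists (2 ^ h./2)%N; rewrite add0n -muln2 expnM.
Qed.

Section Frobenius.

Variables (F : finFieldType) (q : nat).
Hypotheses (hq : exists h : nat, q = (2 ^ h)%N) (hF : #|F| = (q ^ 2)%N).

Lemma q_gt1 : (1 < q)%N.
Proof.
have := card_finRing_gt1 F; rewrite hF; case: hq => h ->.
by case: h => // h _; rewrite expnS; have := expn_gt0 2 h; lia.
Qed.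

Lemma char2F : 2%N \in [pchar F].
Proof.
case: hq hF => h ->; rewrite -expnM => /card_finPcharP; exact.
Qed.

(** The power map x |-> x^q packaged as a ring morphism, the h-th iterate of the
    absolute Frobenius, so that it can be applied entrywise to matrices. *)
Lemma frob_morph : exists sigma : {rmorphism F -> F}, sigma =1 (fun x => x ^+ q).
Proof.
case: hq => h ->; elim: h => [|h [f fE]].
  by exists idfun => x; rewrite expn0 expr1.
exists (GRing.Frobenius_aut char2F \o f)=> x /=.
by rewrite pFrobenius_autE fE -exprM expnSr.
Qed.

Lemma frobK (x : F) : (x ^+ q) ^+ q = x.
Proof. by rewrite -exprM mulnn -hF expf_card. Qed.

Definition subF : {set F} := [set x : F | x ^+ q == x].

(** The polynomial X^q - X divides X^(q^2) - X, since the latter equals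
    ((X^q)^q - X^q) + (X^q - X); as X^(q^2) - X is the product of all X - x, its
    divisor X^q - X has q distinct roots in F. *)
Lemma card_subF : #|subF| = q.
Proof.
pose p : {poly F} := 'X^q - 'X.
have [sigma sigmaE] := frob_morph.
have szp : size p = q.+1.
  by rewrite size_polyDl ?size_polyXn // size_polyN size_polyX ltnS q_gt1.
have pP x : root p x = (x \in subF) by rewrite rootE !hornerE inE subr_eq0.
have : p %| \prod_(x : F) ('X - x%:P).
  rewrite -finField_genPoly hF -mulnn exprM.
  by rewrite -(subrK ('X^q) ('X^q ^+ q)) -addrA dvdp_add // subrXX dvdp_mulr.
case/dvdp_prod_XsubC=> m pE; set r := mask m _ in pE.
have ur : uniq r by rewrite mask_uniq // /index_enum -enumT enum_uniq.
have -> : #|subF| = #|r|.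
  apply: eq_card => x; rewrite -pP (eqp_root pE) root_prod_XsubC //.
by rewrite (card_uniqP ur); apply: succn_inj;
  rewrite -szp (eqp_size pE) size_prod_XsubC.
Qed.

End Frobenius.

(** * Baer subplanes *)

Section Baer.

Variables (F : finFieldType) (q : nat).
Hypotheses (hq : exists h : nat, q = (2 ^ h)%N) (hF : #|F| = (q ^ 2)%N).
Variable sigma : {rmorphism F -> F}.
Hypothesis sigmaE : sigma =1 (fun x => x ^+ q).

Local Notation "A ^s" := (map_mx sigma A) (at level 2, format "A ^s").

Lemma subF_sigma (c : F) : (c \in subF F q) = (sigma c == c).
Proof. by rewrite inE sigmaE. Qed.

Lemma subF01 : 0 \in subF F q /\ 1 \in subF F q.
Proof. by rewrite !subF_sigma rmorph0 rmorph1 !eqxx. Qed.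

Lemma scale_map (m n : nat) (c : F) (A : 'M_(m, n)) : (c *: A)^s = sigma c *: A^s.
Proof. by apply/matrixP=> i j; rewrite !mxE rmorphM. Qed.

(** Hilbert 90 for vectors, made elementary by normalising one coordinate to 1:
    a projective point fixed by sigma has rational coordinates. *)
Lemma descent n (v : 'rV[F]_n) c : v != 0 -> v^s = c *: v ->
  exists2 k, k != 0 & (k *: v)^s = k *: v.
Proof.
move=> vN0 vs; have [i vi] : exists i, v 0 i != 0.
  apply/existsP; apply: contraNT vN0; rewrite negb_exists => /forallP h.
  by apply/eqP/rowP=> i; rewrite mxE; apply/eqP; rewrite -[_ == _]negbK h.
exists (v 0 i)^-1; rewrite ?invr_eq0 // scale_map vs scalerA; congr (_ *: _).
have := congr1 (fun u : 'rV_n => u 0 i) vs; rewrite !mxE fmorphV => sv.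
have : sigma (v 0 i) != 0 by rewrite fmorph_eq0.
by rewrite sv mulf_eq0 negb_or => /andP[cN0 _]; rewrite invfM mulrAC mulVf ?mul1r.
Qed.

Lemma plane_span (u v w : 'rV[F]_3) (a : 'cV_3) :
  (forall s t : F, s *: u + t *: v = 0 -> s = 0 /\ t = 0) -> a != 0 ->
  u *m a = 0 -> v *m a = 0 -> w *m a = 0 -> exists s t, w = s *: u + t *: v.
Proof.
move=> /rank_pair rk aN0 ua va /sub_kermxP wa.
have uva : (col_mx u v <= kermx a)%MS by apply/sub_kermxP;
  rewrite mul_col_mx ua va col_mx0.
have : (w <= col_mx u v)%MS.
  rewrite (submx_trans wa) // -(geq_leqif (mxrank_leqif_sup uva)).
  by rewrite mxrank_ker rank_col // rk.
case/submxP=> D ->; rewrite -[D]hsubmxK mul_row_col.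
rewrite [lsubmx D]mx11_scalar [rsubmx D]mx11_scalar !mul_scalar_mx.
by do 2!eexists.
Qed.

Lemma line_scale (c : F) (a : 'cV[F]_3) : c != 0 -> line (c *: a) = line a.
Proof.
move=> cN0; apply/setP=> P; have [v vN0 ->] := pt_surj P.
by rewrite !mem_line // -scalemxAr scaler_eq0 (negPf cN0).
Qed.

Variable G : 'M[F]_3.
Hypothesis uG : G \in unitmx.

(** The image under G of the standard subplane PG(2,q).  By [descent] it is the
    set of fixed points of the Baer involution v |-> sigma(v G^-1) G. *)
Definition baer : {set point F} :=
  [set pt (w *m G) | w : 'rV[F]_3 & (w != 0) && (w^s == w)].

Lemma mem_baer (v : 'rV[F]_3) c : v != 0 -> v^s = c *: v -> pt (v *m G) \in baer.
Proof.
move=> vN0 /(descent vN0)[k kN0 kv].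
rewrite -(@pt_scale _ k) // scalemxAl; apply: imset_f.
by rewrite inE scaler_eq0 negb_or kN0 vN0 kv /=.
Qed.

Lemma baer_span (a : 'cV[F]_3) : (1 < #|line a :&: baer|)%N ->
  exists u v : 'rV[F]_3, [/\ u^s = u, v^s = v, u *m (G *m a) = 0, v *m (G *m a) = 0
    & forall s t : F, s *: u + t *: v = 0 -> s = 0 /\ t = 0].
Proof.
case/card_gt1P=> x [y [/setIP[xa xB] /setIP[ya yB] xy]].
case/imsetP: xB xa xy => u; rewrite inE => /andP[uN0 /eqP us] ->.
case/imsetP: yB ya => v; rewrite inE => /andP[vN0 /eqP vs] ->.
rewrite !mem_line ?(mulmx_unit_eq0 _ uG) // -!mulmxA => /eqP va /eqP ua uv.
exists u, v; split=> //; apply: nonproportional_indep => // c e.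
case/eqP: uv; rewrite e -scalemxAl pt_scale //.
by apply: contraNneq uN0 => c0; rewrite e c0 scale0r.
Qed.

(** A line through two fixed points of the Baer involution is fixed by it; in
    coordinates, its equation is fixed up to a scalar. *)
Lemma baer_line_stable (a : 'cV[F]_3) : a != 0 -> (1 < #|line a :&: baer|)%N ->
  exists2 c, c != 0 & (G *m a)^s = c *: (G *m a).
Proof.
move=> aN0 /baer_span[u [v [us vs ua va /rank_pair rk]]].
have [|||c e] := coker_line (a := G *m a) (b := (G *m a)^s) rk.
- by rewrite (unit_mulmx_eq0 _ uG).
- by rewrite mul_col_mx ua va col_mx0.
- by rewrite mul_col_mx -{1}us -{1}vs -!map_mxM ua va raddf0 col_mx0.
exists c => //; apply: contraNneq aN0 => c0; move: e.
by rewrite c0 scale0r => /eqP; rewrite map_mx_eq0 (unit_mulmx_eq0 _ uG).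
Qed.

(** Two distinct fixed lines meet in a fixed point. *)
Lemma baer_meet (l m : {set point F}) : l \in lines F -> m \in lines F -> l != m ->
  (1 < #|l :&: baer|)%N -> (1 < #|m :&: baer|)%N -> l :&: m \subset baer.
Proof.
case/imsetP=> a; rewrite inE => aN0 ->; case/imsetP=> b; rewrite inE => bN0 ->.
move=> ab /(baer_line_stable aN0)[c cN0 ac] /(baer_line_stable bN0)[d dN0 bd].
apply/subsetP=> P /setIP[]; have [v vN0 ->] := pt_surj P.
rewrite !mem_line // -[v](mulmxKV uG); set w := v *m _ => wa wb.
have wN0 : w != 0 by rewrite -(mulmx_unit_eq0 _ uG) mulmxKV.
clearbody w.
move: wa wb; rewrite -!mulmxA => /eqP wa /eqP wb.
have ind s t : s *: (G *m a)^T + t *: (G *m b)^T = 0 -> s = 0 /\ t = 0.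
  apply: nonproportional_indep => [|k ek].
    by rewrite -(inj_eq trmx_inj) trmxK trmx0 (unit_mulmx_eq0 _ uG).
  case/eqP: ab; have {}ek : a = k *: b.
    apply/eqP; rewrite -subr_eq0 -(unit_mulmx_eq0 _ uG) mulmxBr -scalemxAr.
    by rewrite -[G *m a]trmxK ek linearZ /= trmxK subrr.
  by rewrite ek line_scale //; apply: contraNneq aN0 => k0; rewrite ek k0 scale0r.
have rk : \rank (row_mx (G *m a) (G *m b)) = 2%N.
  by rewrite -mxrank_tr tr_row_mx (rank_pair ind).
have fixed e (y : 'cV_3) : e != 0 -> y^s = e *: y -> w *m y = 0 -> w^s *m y = 0.
  move=> eN0 ys wy; apply/eqP; have := map_mxM sigma w y.
  rewrite wy raddf0 ys -scalemxAr => /esym/eqP; rewrite scaler_eq0 (negPf eN0) //.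
have [||k wk] := ker_line (w := w^s) rk wN0.
- by rewrite mul_mx_row wa wb row_mx0.
- by rewrite mul_mx_row (fixed c) // (fixed d) // row_mx0.
exact: mem_baer wk.
Qed.

(** With two rational points u and v on the line, the rational points on it are
    u and the s u + v with s in GF(q): uniqueness of coordinates forces the
    coefficients of a rational vector to be fixed by sigma. *)
Lemma baer_line_card (l : {set point F}) : l \in lines F ->
  (1 < #|l :&: baer|)%N -> #|l :&: baer| = q.+1.
Proof.
case/imsetP=> a; rewrite inE => aN0 -> /baer_span[u [v [us vs ua va ind]]].
have uN0 : u != 0.
  apply/eqP=> u0; have [|/eqP] := ind 1 0; first by rewrite u0 scaler0 scale0r addr0.
  by rewrite oner_eq0.
have vN0 s : s *: u + v != 0.
  apply/eqP=> e; have [|_ /eqP] := ind s 1; first by rewrite scale1r.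
  by rewrite oner_eq0.
pose f s := pt ((s *: u + v) *m G).
have -> : line a :&: baer = pt (u *m G) |: f @: subF F q.
  apply/setP=> P; rewrite inE; apply/idP/idP; last first.
    case/setU1P=> [->|/imsetP[s]].
      rewrite mem_line ?(mulmx_unit_eq0 _ uG) // -mulmxA ua eqxx.
      by apply: imset_f; rewrite inE uN0 us /=.
    rewrite subF_sigma => /eqP ss ->;
      rewrite mem_line ?(mulmx_unit_eq0 _ uG) // -mulmxA.
    rewrite mulmxDl -scalemxAl ua va scaler0 addr0 eqxx.
    by apply: imset_f; rewrite inE vN0 map_mxD scale_map ss us vs /=.
  case/andP=> Pa /imsetP[w]; rewrite inE => /andP[wN0 /eqP ws] eP.
  move: Pa; rewrite eP mem_line ?(mulmx_unit_eq0 _ uG) // -mulmxA => /eqP wa.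
  have aN0' : G *m a != 0 by rewrite (unit_mulmx_eq0 _ uG).
  have [s [t ew]] := plane_span ind aN0' ua va wa.
  have [ss st] : sigma s - s = 0 /\ sigma t - t = 0.
    apply: ind; rewrite !scalerBl addrACA -opprD -ew.
    by rewrite -{1}ws ew map_mxD !scale_map us vs subrr.
  have [t0|tN0] := eqVneq t 0.
    rewrite ew t0 scale0r addr0 -scalemxAl pt_scale ?setU11 //.
    by apply: contraNneq wN0 => s0; rewrite ew s0 t0 !scale0r addr0.
  apply/setU1P; right; apply/imsetP; exists (s / t).
    by rewrite subF_sigma fmorph_div (subr0_eq ss) (subr0_eq st).
  have -> : w = t *: ((s / t) *: u + v).
    by rewrite scalerDr scalerA mulrCA mulfV // mulr1.
  by rewrite -scalemxAl pt_scale.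
have uf s : pt (u *m G) <> f s.
  case/(pt_mulmx_inj uG uN0 (vN0 s))=> c cN0 e.
  have [|_ /eqP] := ind (1 - c * s) (- c); last by rewrite oppr_eq0 (negPf cN0).
  by rewrite scalerBl scale1r scaleNr -scalerA -addrA -opprD -scalerDr -e subrr.
rewrite cardsU1 card_imset ?card_subF //.
  by case: imsetP => // -[s _ /uf].
move=> s t /(pt_mulmx_inj uG (vN0 s) (vN0 t))[c cN0 e].
have [|/subr0_eq es /subr0_eq ec] := ind (s - c * t) (1 - c).
  rewrite !scalerBl scale1r -scalerA addrACA -opprD -scalerDr e subrr //.
by rewrite es -ec mul1r.
Qed.

(** The standard frame e_0, e_1, e_2, e_0 + e_1 + e_2. *)
Lemma baer_quadrangle : exists S : {set point F},
  [&& S \subset baer, #|S| == 4%N & [forall l in lines F, (#|l :&: S| <= 2)%N]].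
Proof.
(* Index 3 is the unit point of the frame, whose three coordinates are 1. *)
pose e (k : 'I_4) : 'rV[F]_3 := \row_j ((k == 3%N :> nat) || (k == j :> nat))%:R.
have eN0 k : e k != 0.
  apply/eqP=> /rowP ek; case: (ltnP k 3) => hk.
    by move/eqP: (ek (Ordinal hk)); rewrite !mxE eqxx orbT oner_eq0.
  move/eqP: (ek 0); rewrite !mxE (_ : (k == 3%N :> nat)) ?oner_eq0 //.
  by rewrite eqn_leq hk -ltnS ltn_ord.
pose f k := pt (e k *m G).
have injf : injective f.
  move=> k l /(pt_mulmx_inj uG (eN0 k) (eN0 l))[c cN0 ekl].
  have h (j : 'I_3) : ((k == 3%N :> nat) || (k == j :> nat)) = ((l == 3%N :> nat) ||
    (l == j :> nat)).
    have := congr1 (fun w : 'rV_3 => w 0 j == 0) ekl.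
    rewrite !mxE mulf_eq0 (negPf cN0) /=.
    by do 2![case: (_ || _)]; rewrite /= ?eqxx ?oner_eq0.
  apply: val_inj; move: (h 0) (h 1) (h ord_max) => /=.
  by case: (k) => -[|[|[|[|//]]]] ?; case: (l) => -[|[|[|[|//]]]].
exists (f @: setT); apply/and3P; split.
- apply/subsetP=> _ /imsetP[k _ ->]; apply: imset_f; rewrite inE eN0.
  by apply/eqP/rowP=> j; rewrite !mxE rmorph_nat.
- by rewrite card_imset // cardsT card_ord.
apply/forall_inP=> l /imsetP[a]; rewrite inE => aN0 ->{l}.
have sub : line a :&: f @: setT \subset f @: [set k | f k \in line a].
  apply/subsetP=> P /setIP[Pa /imsetP[k _ ek]].
  by rewrite ek imset_f // inE -ek.
apply: leq_trans (subset_leq_card sub) _; apply: leq_trans (leq_imset_card _ _) _.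
rewrite -sum1_card big_mkcond /= !big_ord_recl big_ord0 !inE /f !mem_line
  ?(mulmx_unit_eq0 _ uG) // -!mulmxA.
move: aN0; rewrite -(unit_mulmx_eq0 _ uG); move: (G *m a) => {sub}a aN0.
(* On the frame, the linear form a takes the values a_0, a_1, a_2 and their sum;
   at most two of these four vanish unless a = 0. *)
have val k : (e k *m a == 0) = (\sum_j e k 0 j * a j 0 == 0).
  rewrite [_ *m _]mx11_scalar mxE; apply/eqP/eqP=> [/matrixP/(_ 0 0)|->].
    by rewrite !mxE.
  by rewrite raddf0.
have : [|| a 0 0 != 0, a (lift ord0 ord0) 0 != 0 | a (lift ord0 (lift ord0 ord0)) 0 !=
  0].
  apply: contraNT aN0; rewrite !negb_or !negbK => /and3P[/eqP a0 /eqP a1 /eqP a2].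
  apply/eqP/colP=> i; rewrite mxE; case: (unliftP 0 i) => [j ->|-> //].
  by case: (unliftP 0 j) => [k ->|-> //]; rewrite ord1.
rewrite !val !big_ord_recl !big_ord0 !mxE /= !(mul1r, mul0r, addr0, add0r).
move: (a _ _) (a _ _) (a _ _) => x y z {val aN0}.
have [x0|xN0] := eqVneq x 0; have [y0|yN0] := eqVneq y 0; have [z0|zN0] := eqVneq z 0;
  rewrite ?x0 ?y0 ?z0 ?add0r ?addr0 //= ?eqxx;
    by [|case: eqP|rewrite (negPf xN0)|rewrite (negPf yN0)|rewrite (negPf zN0)].
Qed.

Lemma baer_subplane : subplane q baer.
Proof.
apply/and3P; split.
- by case: baer_quadrangle => S hS; apply/existsP; exists S.
- apply/forall_inP=> l lL; apply/forall_inP=> m mL; apply/implyP=> /and3P[].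
  exact: baer_meet.
- by apply/forall_inP=> l lL; apply/implyP=> hl; rewrite baer_line_card.
Qed.

End Baer.

(** * New lines in coordinates *)

Section NewLines.

Variables (F : finFieldType) (q : nat).
Hypotheses (hq : exists h : nat, q = (2 ^ h)%N) (hF : #|F| = (q ^ 2)%N).
Variable sigma : {rmorphism F -> F}.
Hypothesis sigmaE : sigma =1 (fun x => x ^+ q).

Local Notation E := (subF F q).

Definition vec (s t : F) : 'rV[F]_2 := \row_j (if j == 0 then s else t).

Lemma vecE s t : (vec s t 0 0 = s) * (vec s t 0 1 = t).
Proof. by rewrite !mxE. Qed.

Lemma vec_coord (w : 'rV[F]_2) : w = vec (w 0 0) (w 0 1).
Proof.
apply/rowP=> i; case: (unliftP 0 i) => [j ->|->]; last by rewrite vecE.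
by rewrite ord1 (_ : lift 0 0 = 1) ?vecE //; apply: val_inj.
Qed.

Lemma vecD s t s' t' c : vec s t + c *: vec s' t' = vec (s + c * s') (t + c * t').
Proof. by apply/rowP=> i; rewrite !mxE; case: ifP. Qed.

Lemma vecZ c s t : c *: vec s t = vec (c * s) (c * t).
Proof. by apply/rowP=> i; rewrite !mxE; case: ifP. Qed.

Lemma vec_inj s t s' t' : vec s t = vec s' t' -> s = s' /\ t = t'.
Proof. by move=> e; rewrite -(vecE s t).1 -{2}(vecE s t).2 e !vecE. Qed.

Lemma vec_eq0 s t : (vec s t == 0) = (s == 0) && (t == 0).
Proof.
apply/eqP/andP=> [e|[/eqP-> /eqP->]]; last by apply/rowP=> i; rewrite !mxE if_same.
have e0 : vec s t = vec 0 0 by rewrite e; apply/rowP=> i; rewrite !mxE if_same.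
by have [-> ->] := vec_inj e0; rewrite eqxx.
Qed.

(** The zero vector is included, unlike in [subvec], so that [ratV] is the
    GF(q)-space GF(q)^2. *)
Definition ratV : {set 'rV[F]_2} := [set w : 'rV[F]_2 | [forall j, w 0 j ^+ q == w 0
  j]].

Lemma ratVP w : (w \in ratV) = (map_mx sigma w == w).
Proof.
rewrite inE; apply/forallP/eqP=> [h|e j].
  by apply/rowP=> j; rewrite mxE sigmaE; apply/eqP.
by rewrite -sigmaE -[in X in _ == X]e mxE.
Qed.

Lemma ratV_vec s t : (vec s t \in ratV) = (s \in E) && (t \in E).
Proof.
rewrite ratVP !(subF_sigma sigmaE); apply/eqP/andP=> [e|[/eqP es /eqP et]].
  have := congr1 (fun u : 'rV_2 => u 0 0) e; have := congr1 (fun u : 'rV_2 => u 0 1) e.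
  by rewrite !mxE /= => -> ->.
by apply/rowP=> i; rewrite !mxE; case: ifP; rewrite ?es ?et.
Qed.

Lemma subvecE : subvec F q = ratV :\ 0.
Proof. by apply/setP=> w; rewrite !inE. Qed.

Lemma card_ratV : #|ratV| = (q ^ 2)%N.
Proof.
have -> : (q ^ 2)%N = #|setX E E| by rewrite cardsX card_subF.
rewrite -(@card_imset _ _ (fun st => vec st.1 st.2)) => [|[s t] [s' t'] /= e].
  apply: eq_card => w; apply/idP/imsetP=> [|[[s t]]].
    rewrite [w]vec_coord ratV_vec => h; exists (w 0 0, w 0 1) => //.
    by rewrite in_setX.
  by rewrite in_setX => h ->; rewrite ratV_vec.
by have [-> ->] := vec_inj e.
Qed.

Variable M : 'M[F]_2.
Hypothesis uM : M \in unitmx.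

Local Notation D := (subline_of q M).

Lemma mem_subline w : w \in ratV -> w != 0 -> ptinf (w *m M) \in D.
Proof. by move=> wR wN0; apply: imset_f; rewrite subvecE !inE wN0;
  rewrite inE in wR. Qed.

Definition new_line (x : 'rV[F]_2) (lam : F) : {set point F} :=
  [set aff (x + lam *: (w *m M)) | w in ratV].

(** The matrix with rows (lam M, 0) and (x, 1) maps PG(2,q) to a subplane whose
    infinite points are D and whose affine points form the given set. *)
Lemma new_line_in x lam : lam != 0 -> new_line x lam \in new_lines q D.
Proof.
move=> lN0; pose G : 'M[F]_(2 + 1) := block_mx (lam *: M) 0 x 1%:M.
have uG : (G : 'M_3) \in unitmx.
  rewrite unitmxE (det_lblock (lam *: M) x 1%:M) det1 mulr1.
  by rewrite detZ unitrM unitrX ?unitfE //= -unitfE -unitmxE.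
have mulG (w : 'rV[F]_2) (z : 'rV[F]_1) :
    (row_mx w z : 'rV_3) *m (G : 'M_3) = row_mx (lam *: (w *m M) + z *m x) z.
  by rewrite -[LHS]/(row_mx w z *m G) mul_row_block mulmx0 add0r mulmx1 -scalemxAr.
apply/imsetP; exists (baer sigma G).
  rewrite inE (baer_subplane hq hF sigmaE uG); apply/subsetP=> P /imsetP[w].
  rewrite subvecE => /setD1P[wN0 wR] ->{P}.
  rewrite -(ptinf_scale _ lN0) /ptinf -[X in row_mx X]addr0 -[X in row_mx (_ +
    X)](mul0mx _ x) -mulG.
  apply: imset_f; rewrite inE row_inf_neq0 wN0 /=; rewrite ratVP in wR.
  by rewrite -[map_mx _ _]/(map_mx sigma (row_mx w 0)) map_row_mx (eqP wR) raddf0.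
rewrite affine_part; apply/setP=> P; apply/imsetP/imsetP=> [[w wR ->]|[y]].
  exists (x + lam *: (w *m M)) => //; rewrite inE /aff.
  rewrite addrC -[X in row_mx (_ + X)]mul1mx -mulG.
  apply: imset_f; rewrite inE row_aff_neq0 /=; rewrite ratVP in wR.
  by rewrite -[map_mx _ _]/(map_mx sigma (row_mx w 1%:M)) map_row_mx (eqP wR) map_mx1.
rewrite inE => /imsetP[v]; rewrite inE => /andP[vN0 vR] + ->; move: vN0 vR.
rewrite -[v](@hsubmxK _ 1 2 1); move: (lsubmx _) (rsubmx _) => w z vN0 /eqP vR.
have {vR} : row_mx (map_mx sigma w) (map_mx sigma z) = row_mx w z.
  by rewrite -[RHS]vR -map_row_mx.
case/eq_row_mx=> ws zs; rewrite mulG => /pt_row_inj[||c [cN0 ey ez]].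
- exact: row_aff_neq0.
- by rewrite -mulG (mulmx_unit_eq0 _ uG).
(* An affine rational point has z <> 0; normalising z to 1 keeps it rational. *)
have {}ez : c * z 0 0 = 1 by move/matrixP/(_ 0 0): ez; rewrite !mxE.
have cs : sigma c = c.
  have : sigma (c * z 0 0) = 1 by rewrite ez rmorph1.
  have := congr1 (fun u : 'rV[F]_1 => u 0 0) zs; rewrite /= mxE rmorphM => ->.
  by rewrite -ez => /mulIf; apply; apply: contraTneq (oner_neq0 F) => z0;
    rewrite -ez z0 mulr0 eqxx.
exists (c *: w); first by rewrite ratVP scale_map cs ws.
rewrite ey scalerDr [z]mx11_scalar mul_scalar_mx !scalerA mulrC ez scale1r addrC.
by rewrite -scalemxAl scalerA mulrC.
Qed.

(** Two lines of the subplane, given by an affine point and a direction each,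
    meet inside the subplane. *)
Lemma subplane_closed (B : {set point F}) x y d e s t : subplane q B ->
  aff x \in B -> aff y \in B -> d != 0 -> e != 0 -> ptinf d \in B -> ptinf e \in B ->
  (forall c, d <> c *: e) -> x + s *: d = y + t *: e -> aff (x + s *: d) \in B.
Proof.
case/and3P=> _ /forall_inP Bmeet _ xB yB dN0 eN0 dB eB de exy.
have big z f : aff z \in B -> f != 0 -> ptinf f \in B -> (1 < #|affine_line z f :&:
  B|)%N.
  move=> zB fN0 fB; apply/card_gt1P; exists (aff z), (ptinf f); split.
  - by rewrite inE zB andbT; apply/aff_in_affine_line=> //; exists 0;
    rewrite scale0r addr0.
  - by rewrite inE fB andbT; apply/ptinf_in_affine_line=> //; exists 1; rewrite scale1r.
  - by apply: contraTneq (ptinf_linf fN0) => <-; apply: aff_linf.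
have /forall_inP/(_ _ (affine_line_in y eN0))/implyP := Bmeet _ (affine_line_in x dN0).
rewrite !big // !andbT => /(_ _)/subsetP; apply; last first.
  rewrite inE; apply/andP; split; first by apply/aff_in_affine_line=> //; exists s.
  by rewrite exy; apply/aff_in_affine_line=> //; exists t.
apply/eqP=> same; have : ptinf d \in affine_line x d by apply/ptinf_in_affine_line=>
  //; exists 1; rewrite scale1r.
by rewrite same => /(ptinf_in_affine_line _ eN0 dN0)[c /de].
Qed.

(** Fix an affine point p of the subplane and use coordinates (s, t) for the
    point p + s r_1 + t r_2, where r_1 and r_2 are the rows of M.  All rational
    directions belong to D, so the subplane is closed under intersecting lines
    with rational directions.  Projecting along (1,0), (0,1) and (1,1) shows that
    it consists of the points with both coordinates in one set Lam; projecting
    along (1,t) shows that Lam is closed under multiplication by GF(q).  The line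
    through p with direction r_1 carries q + 1 points of the subplane, so
    #|Lam| = q and Lam = lam GF(q). *)
Lemma new_line_of_subplane L : L \in new_lines q D -> exists x lam, lam != 0 /\ L =
  new_line x lam.
Proof.
case/imsetP=> B; rewrite inE => /andP[Bsub /subsetP DB] ->.
(* A quadrangle has at most two points on the line at infinity. *)
have [p pB] : exists p, aff p \in B.
  have /and3P[/existsP[S /and3P[SB S4 /forall_inP/(_ _ (linf_in F)) h]] _ _] := Bsub.
  have [P PS PN] : exists2 P, P \in S & P \notin linf F.
    apply/exists_inP; apply: contraLR h; rewrite -ltnNge => /exists_inPn/= h.
    suff -> : linf F :&: S = S by rewrite (eqP S4).
    by apply/setIidPr/subsetP=> P /h; rewrite negbK.
  have [[d dN0 eP]|[p eP]] := point_cases P; first by rewrite eP ptinf_linf in PN.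
  by exists p; rewrite -eP (subsetP SB).
pose H s t := aff (p + vec s t *m M) \in B.
(* (x, y) is the meet of the line from (s, t) in direction (d1, d2) with the line
   from (s', t') in direction (e1, e2); k and k' are the parameters on them. *)
have cl x y s t s' t' d1 d2 e1 e2 k k' : H s t -> H s' t' ->
    [&& d1 \in E, d2 \in E, e1 \in E & e2 \in E] -> d1 * e2 - d2 * e1 != 0 ->
    [/\ x = s + k * d1, x = s' + k' * e1, y = t + k * d2 & y = t' + k' * e2] -> H x y.
  move=> h1 h2 /and4P[d1E d2E e1E e2E] det [ex ex' ey ey'].
  have dN0 : vec d1 d2 != 0.
    by apply: contraNneq det => /eqP; rewrite vec_eq0 => /andP[/eqP-> /eqP->];
      rewrite !mul0r subrr.
  have eN0 : vec e1 e2 != 0.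
    by apply: contraNneq det => /eqP; rewrite vec_eq0 => /andP[/eqP-> /eqP->];
      rewrite !mulr0 subrr.
  have step u v c w1 w2 : p + vec u v *m M + c *: (vec w1 w2 *m M) =
      p + vec (u + c * w1) (v + c * w2) *m M.
    by rewrite scalemxAl -addrA -mulmxDl vecD.
  rewrite /H {1}ex ey -step.
  apply: (@subplane_closed B _ (p + vec s' t' *m M) _ (vec e1 e2 *m M) k k') => //.
  - by rewrite (mulmx_unit_eq0 _ uM).
  - by rewrite (mulmx_unit_eq0 _ uM).
  - by apply/DB/mem_subline; rewrite // ratV_vec d1E.
  - by apply/DB/mem_subline; rewrite // ratV_vec e1E.
  - move=> c; rewrite scalemxAl => e; case/eqP: det.
    have {}e : vec d1 d2 = c *: vec e1 e2.
      by apply/eqP; rewrite -subr_eq0 -(mulmx_unit_eq0 _ uM) mulmxBl e subrr.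
    by move: e; rewrite vecZ => /vec_inj[-> ->]; ring.
  - by rewrite !step -ex -ex' -ey -ey'.
have [E0 E1] := subF01 sigmaE.
have H00 : H 0 0 by rewrite /H (_ : vec 0 0 = 0) ?mul0mx ?addr0 //; apply/eqP;
  rewrite vec_eq0 eqxx.
have fst s t : H s t -> H s 0.
  move=> h; apply: (cl s 0 s t 0 0 0 1 1 0 (- t) s h H00); rewrite ?E0 ?E1 //.
    by rewrite mul0r mul1r sub0r oppr_eq0 oner_neq0.
  by split; ring.
have snd s t : H s t -> H 0 t.
  move=> h; apply: (cl 0 t s t 0 0 1 0 0 1 (- s) t h H00); rewrite ?E0 ?E1 //.
    by rewrite mul0r mul1r subr0 oner_neq0.
  by split; ring.
have pair s t : H s 0 -> H 0 t -> H s t.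
  move=> h h'; apply: (cl s t s 0 0 t 0 1 1 0 t s h h'); rewrite ?E0 ?E1 //.
    by rewrite mul0r mul1r sub0r oppr_eq0 oner_neq0.
  by split; ring.
have up c t : H c 0 -> t \in E -> H 0 (c * t).
  move=> h tE; apply: (snd c); apply: (cl c _ c 0 0 0 0 1 1 t (c * t) c h H00).
  - by rewrite E0 E1.
  - by rewrite mul0r mul1r sub0r oppr_eq0 oner_neq0.
  by split; ring.
have down c : H 0 c -> H c 0.
  move=> h; apply: (fst c c); apply: (cl c c 0 c 0 0 1 0 1 1 c c h H00).
  - by rewrite E0 E1.
  - by rewrite mul0r mul1r subr0 oner_neq0.
  by split; ring.
pose Lam := [set c | H c 0].
have r1N0 : vec 1 0 != 0 by rewrite vec_eq0 oner_eq0.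
have r1MN0 : vec 1 0 *m M != 0 by rewrite (mulmx_unit_eq0 _ uM).
have r1B : ptinf (vec 1 0 *m M) \in B by apply/DB/mem_subline;
  rewrite // ratV_vec E0 E1.
have Hc c : p + c *: (vec 1 0 *m M) = p + vec c 0 *m M.
  by rewrite scalemxAl vecZ mulr1 mulr0.
have cLam : #|Lam| = q.
  have /and3P[_ _ /forall_inP/(_ _ (affine_line_in p r1MN0))/implyP h] := Bsub.
  have eB : affine_line p (vec 1 0 *m M) :&: B =
      ptinf (vec 1 0 *m M) |: [set aff (p + c *: (vec 1 0 *m M)) | c in Lam].
    apply/setP=> P; rewrite !inE; apply/andP/orP=> [[Pl PB]|[/eqP->|/imsetP[c]]].
    - have [[d dN0 eP]|[y eP]] := point_cases P.
        left; move: Pl; rewrite eP => /(ptinf_in_affine_line _ r1MN0 dN0)[c ed].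
        rewrite ed ptinf_scale //; apply: contraNneq dN0 => c0.
        by rewrite ed c0 scale0r.
      right; move: Pl; rewrite eP => /(aff_in_affine_line _ _ r1MN0)[c ey].
      by apply/imsetP; exists c; rewrite ?ey // inE /H -Hc -ey -eP.
    - by split=> //; apply/ptinf_in_affine_line=> //; exists 1; rewrite scale1r.
    - rewrite inE => Hc0 ->; rewrite Hc; split=> //.
      by rewrite -Hc; apply/aff_in_affine_line=> //; exists c.
  have : #|affine_line p (vec 1 0 *m M) :&: B| = q.+1.
    apply/eqP/h/card_gt1P; exists (aff p), (ptinf (vec 1 0 *m M)); split.
    - rewrite inE; apply/andP; split; first by apply/aff_in_affine_line=> //;
      exists 0; rewrite scale0r addr0.
      by move: H00; rewrite /H -Hc scale0r addr0.
    - by rewrite inE r1B andbT; apply/ptinf_in_affine_line=> //; exists 1;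
      rewrite scale1r.
    - by apply: contraTneq (ptinf_linf r1MN0) => <-; apply: aff_linf.
  rewrite eB cardsU1 card_imset.
    case: imsetP => [[c _ e]|_]; last by rewrite add1n => -[].
    by move: (ptinf_linf r1MN0); rewrite e (negPf (aff_linf _)).
  move=> c c' /aff_inj/addrI/eqP; rewrite -subr_eq0 -scalerBl scaler_eq0.
  by rewrite (negPf r1MN0) orbF subr_eq0 => /eqP.
have [lam lamL lN0] : exists2 lam, lam \in Lam & lam != 0.
  have : (0 < #|Lam :\ 0%R|)%N.
    have := q_gt1 hq hF; rewrite -cLam (cardsD1 (0 : F)); case: (_ \in Lam);
      rewrite ?add0n ?add1n //; apply: ltnW.
  by case/card_gt0P=> lam /setD1P[]; exists lam.
(* One inclusion is closure under GF(q); both sets have q elements. *)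
have LamE : Lam = [set lam * t | t in E].
  apply/esym/eqP; rewrite eqEcard; apply/andP; split.
    apply/subsetP=> _ /imsetP[t tE ->]; rewrite inE; apply/down/up => //.
    by rewrite inE in lamL.
  rewrite cLam card_imset ?(card_subF hq hF) //; exact: mulfI.
exists p, lam; split=> //; rewrite affine_part; apply/setP=> P.
apply/imsetP/imsetP=> [[y]|[w wR ->]].
  rewrite inE; have [s [t ->]] : exists s t, y = p + vec s t *m M.
    pose w := (y - p) *m invmx M; exists (w 0 0), (w 0 1).
    by rewrite -vec_coord mulmxKV // addrC subrK.
  move=> {y} h ->.
  have /imsetP[s' s'E es] : s \in [set lam * t | t in E] by rewrite -LamE inE (fst s t).
  have /imsetP[t' t'E et] : t \in [set lam * t | t in E].
    by rewrite -LamE inE down // (snd s t).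
  exists (vec s' t'); first by rewrite ratV_vec s'E.
  by rewrite scalemxAl vecZ es et.
exists (p + lam *: (w *m M)) => //; rewrite inE scalemxAl.
move: wR; rewrite [w]vec_coord ratV_vec vecZ => /andP[w0 w1].
have lE c : c \in E -> H (lam * c) 0.
  by move=> cE; have : lam * c \in Lam by [rewrite LamE imset_f]; rewrite inE.
by apply: pair; [apply: lE | rewrite -[lam * _]mulr1 up // lE].
Qed.

Lemma new_line_base x lam p : aff p \in new_line x lam -> new_line x lam = new_line p
  lam.
Proof.
case/imsetP=> w0 w0R /aff_inj ->; apply/setP=> P.
have ratB u v : u \in ratV -> v \in ratV -> (u - v \in ratV) && (u + v \in ratV).
  rewrite !ratVP => /eqP eu /eqP ev.
  by rewrite map_mxD map_mxD map_mxN eu ev !eqxx.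
apply/imsetP/imsetP=> -[w wR ->].
  exists (w - w0); first by have /andP[] := ratB _ _ wR w0R.
  by rewrite mulmxBl -addrA -scalerDr [w0 *m M + _]addrC subrK.
exists (w + w0); first by have /andP[] := ratB _ _ wR w0R.
by rewrite mulmxDl -addrA -scalerDr [w0 *m M + _]addrC.
Qed.

End NewLines.

(** * Ternary quadratic forms *)

Section QuadraticForms.

Lemma mpolyX_deg2 (R : comNzRingType) n (m : 'X_{1..n}) : mdeg m = 2%N ->
  exists i j, 'X_[R, m] = 'X_i * 'X_j.
Proof.
move=> m2; have [i mi] : exists i, m i != 0%N.
  apply/existsP; apply: contra_eqT m2; rewrite negb_exists => /forallP h.
  by rewrite mdegE big1 // => i _; apply/eqP; rewrite -[_ == _]negbK h.
have Um : (U_(i) <= m)%MM by rewrite lep1mP.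
have /mdeg1P[j /eqP ej] : mdeg (m - U_(i))%MM == 1%N.
  by have := congr1 mdeg (submK Um); rewrite mdegD mdeg1 m2 addn1 => -[->].
by exists j, i; rewrite -mpolyXD -ej submK.
Qed.

(** The coefficients C i j are not unique: only C i j + C j i matters.  The form
    is needed both for evaluating Q and for factoring it. *)
Lemma homog2_sum (R : comNzRingType) n (Q : {mpoly R[n]}) : Q \is 2.-homog ->
  exists C : 'M[R]_n, Q = \sum_i \sum_j C i j *: ('X_i * 'X_j).
Proof.
move/dhomogP=> Qh; rewrite [Q]mpolyE big_seq.
apply: (big_ind (fun p => exists C : 'M[R]_n, p = \sum_i \sum_j C i j *: ('X_i *
  'X_j))).
- by exists 0; rewrite big1 // => i _; rewrite big1 // => j _; rewrite mxE scale0r.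
- move=> _ _ [C ->] [C' ->]; exists (C + C'); rewrite -big_split; apply: eq_bigr => i _.
  by rewrite -big_split; apply: eq_bigr => j _; rewrite mxE scalerDl.
move=> m /Qh/(@mpolyX_deg2 R)[i [j ->]]; exists (Q@_m *: delta_mx i j).
rewrite (bigD1 i) //= (bigD1 j) //= !mxE !eqxx mulr1 !big1 ?addr0 //.
  by move=> k ki; rewrite big1 // => l _; rewrite !mxE (negPf ki) mulr0 scale0r.
by move=> l lj; rewrite !mxE (negPf lj) andbF mulr0 scale0r.
Qed.

Lemma mpoly_linear_const (F : fieldType) n (g : 'I_n -> F) :
  (msize (\sum_i g i *: 'X_i : {mpoly F[n]}) <= 1)%N -> \sum_i g i *: 'X_i = 0 :>
    {mpoly F[n]}.
Proof.
move=> sz; have h1 : (\sum_i g i *: 'X_i : {mpoly F[n]}) \is 1.-homog.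
  by apply: rpred_sum => i _; apply: rpredZ; rewrite dhomogX; apply/eqP/mdeg1.
apply/eqP; apply: contraT => gN0; move: sz;
  rewrite leq_eqVlt ltnS leqn0 mmeasure_poly_eq0.
rewrite (negPf gN0) orbF => /eqP sz.
by have := dhomog_uniq gN0 h1 (dhomog_msize h1); rewrite sz.
Qed.

(** The second half is irreducibility over F, the form in which it is used: a
    degenerate form with an affine zero splits already over F. *)
Lemma conic_coords (F : finFieldType) (K : {set point F}) : conic K ->
  exists a b c d e f : F,
    (forall v : 'rV[F]_3, v != 0 -> (pt v \in K) =
      (a * v 0 0 ^+ 2 + b * v 0 1 ^+ 2 + c * v 0 ord_max ^+ 2 + d * (v 0 0 * v 0 1)
       + e * (v 0 0 * v 0 ord_max) + f * (v 0 1 * v 0 ord_max) == 0)) /\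
    (forall g0 g1 g2 h0 h1 h2 : F, a = g0 * h0 -> b = g1 * h1 -> c = g2 * h2 ->
      d = g0 * h1 + g1 * h0 -> e = g0 * h2 + g2 * h0 -> f = g1 * h2 + g2 * h1 -> False).
Proof.
case=> Q [/homog2_sum[C QE] [szQ irr] ->].
have l1 : lift ord0 ord0 = 1 :> 'I_3 by apply: val_inj.
have l2 : lift ord0 (lift ord0 ord0) = ord_max :> 'I_3 by apply: val_inj.
have l0 : ord0 = 0 :> 'I_3 by apply: val_inj.
exists (C 0 0), (C 1 1), (C ord_max ord_max), (C 0 1 + C 1 0),
  (C 0 ord_max + C ord_max 0), (C 1 ord_max + C ord_max 1); split=> [v vN0|].
  have Qv (u : 'rV[F]_3) : Q.@[u 0] = \sum_i \sum_j C i j * (u 0 i * u 0 j).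
    rewrite QE raddf_sum; apply: eq_bigr => i _; rewrite raddf_sum;
      apply: eq_bigr => j _ /=.
    by rewrite mevalZ mevalM !mevalXU.
  have Qv3 (u : 'rV[F]_3) : Q.@[u 0] = C 0 0 * u 0 0 ^+ 2 + C 1 1 * u 0 1 ^+ 2 + C
    ord_max ord_max * u 0 ord_max ^+ 2
     + (C 0 1 + C 1 0) * (u 0 0 * u 0 1) + (C 0 ord_max + C ord_max 0) * (u 0 0 * u 0
       ord_max)
     + (C 1 ord_max + C ord_max 1) * (u 0 1 * u 0 ord_max).
    by rewrite Qv !big_ord_recl !big_ord0 l2 l1 l0; ring.
  rewrite -Qv3; apply/imsetP/idP=> [[w]|Qv0]; last by exists v; rewrite ?inE ?vN0.
  rewrite inE => /andP[wN0 /eqP Qw] /(pt_inj vN0 wN0)[k _ ->].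
  suff -> : Q.@[(k *: w) 0] = k ^+ 2 * Q.@[w 0] by rewrite Qw mulr0.
  by rewrite !Qv3 !mxE; ring.
move=> g0 g1 g2 h0 h1 h2 ea eb ec ed ee ef.
pose g (i : 'I_3) := [:: g0; g1; g2]`_i; pose h (i : 'I_3) := [:: h0; h1; h2]`_i.
pose G : {mpoly F[3]} := \sum_i g i *: 'X_i;
  pose H : {mpoly F[3]} := \sum_i h i *: 'X_i.
have fact : Q = G * H.
  rewrite QE /G /H !big_ord_recl !big_ord0 l2 l1 l0 /g /h /= -!mul_mpolyC !addr0.
  move: (congr1 (@mpolyC 3 F) ea) (congr1 (@mpolyC 3 F) eb) (congr1 (@mpolyC 3 F) ec).
  move: (congr1 (@mpolyC 3 F) ed) (congr1 (@mpolyC 3 F) ee) (congr1 (@mpolyC 3 F) ef).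
  rewrite !mpolyCD !mpolyCM => /(canRL (addrK _)) -> /(canRL (addrK _)) ->.
  by move=> /(canRL (addrK _)) -> -> -> ->; ring.
have id : map_mpoly (idfun : {rmorphism F -> F}) Q = G * H.
  by rewrite -fact; apply/mpolyP=> m; rewrite mcoeff_map_mpoly.
have [/mpoly_linear_const G0|/mpoly_linear_const H0] := irr F _ G H id.
  by move: szQ; rewrite fact /G G0 mul0r mmeasure0.
by move: szQ; rewrite fact /H H0 mulr0 mmeasure0.
Qed.

End QuadraticForms.

(** * Parabolas in even characteristic *)

Section Parabolas.

Variables (F : finFieldType) (q : nat).
Hypotheses (hq : exists h : nat, q = (2 ^ h)%N) (hF : #|F| = (q ^ 2)%N).

(** Since x^(q^2) = x and q^2 is even, x^(q^2/2) is a square root of x. *)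
Lemma sqrt_exists (a : F) : exists b, b ^+ 2 = a.
Proof.
exists (a ^+ (q ^ 2)./2); rewrite -exprM muln2.
have -> : ((q ^ 2)./2.*2 = #|F|)%N.
  rewrite hF; apply: even_halfK; rewrite oddX /=.
  by have := q_gt1 hq hF; case: hq => h ->; case: h => // h _; rewrite oddX.
exact: expf_card.
Qed.

(** Writing 0 as a multiple of 1 + 1 is how characteristic 2 enters the identities
    that [ring] proves. *)
Lemma add11_eq0 : 1 + 1 = 0 :> F.
Proof. exact: (addrr_pchar2 (char2F hq hF)). Qed.

Definition lin_form (a b : F) (x : 'rV[F]_2) : F := a * x 0 0 + b * x 0 1.

Lemma lin_formD a b x y : lin_form a b (x + y) = lin_form a b x + lin_form a b y.
Proof. by rewrite /lin_form !mxE; ring. Qed.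

Lemma lin_formZ a b c x : lin_form a b (c *: x) = c * lin_form a b x.
Proof. by rewrite /lin_form !mxE; ring. Qed.

Lemma row3E (x : 'rV[F]_2) (z : 'rV[F]_1) (u := row_mx x z : 'rV[F]_3) :
  [/\ u 0 0 = x 0 0, u 0 1 = x 0 1 & u 0 ord_max = z 0 0].
Proof.
split.
- have := row_mxEl x z 0 0; rewrite (_ : (lshift 1 (0 : 'I_2) : 'I_3) = 0) //;
  exact: val_inj.
- have := row_mxEl x z 0 1; rewrite (_ : (lshift 1 (1 : 'I_2) : 'I_3) = 1) //;
  exact: val_inj.
have := row_mxEr x z 0 0; rewrite (_ : (rshift 2 (0 : 'I_1) : 'I_3) = ord_max) //;
  exact: val_inj.
Qed.

(** Cramer's rule. *)
Lemma indep_forms_ker (d : 'rV[F]_2) (al be e f : F) : al * f - be * e != 0 ->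
  lin_form al be d = 0 -> lin_form e f d = 0 -> d = 0.
Proof.
rewrite /lin_form => det h1 h2; rewrite [d]vec_coord; apply/eqP; rewrite vec_eq0.
have c0 : (al * f - be * e) * d 0 0 = f * (al * d 0 0 + be * d 0 1) - be * (e * d 0 0
  + f * d 0 1) by ring.
have c1 : (al * f - be * e) * d 0 1 = al * (e * d 0 0 + f * d 0 1) - e * (al * d 0 0 +
  be * d 0 1) by ring.
move/eqP: c0; move/eqP: c1; rewrite h1 h2 !mulr0 subrr !mulf_eq0 (negPf det) /=.
by move=> -> ->.
Qed.

Lemma lin_form_ker (d : 'rV[F]_2) (e f : F) : (e != 0) || (f != 0) -> lin_form e f d =
  0 ->
  exists t, d = t *: vec f (- e).
Proof.
move=> ef h; apply: perp_ker.
  by rewrite vec_eq0 negb_and oppr_eq0 orbC.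
rewrite mul_perp !vecE; have -> : d 0 0 * - e - d 0 1 * f = - lin_form e f d by
  rewrite /lin_form; ring.
by rewrite h oppr0 raddf0.
Qed.

(** If d were nonzero, the polar form d (u_0 v_1 - u_1 v_0) would be
    nondegenerate, and the line through the zero u and any other point v would
    contain a second zero v + t u, with t = phi(v) / polar(u, v). *)
Lemma cross_coef_eq0 (a b d : F) (u : 'rV[F]_2)
    (phi := fun w : 'rV[F]_2 =>
      a * w 0 0 ^+ 2 + b * w 0 1 ^+ 2 + d * (w 0 0 * w 0 1)) :
  u != 0 -> phi u = 0 ->
  (forall w, w != 0 -> phi w = 0 -> exists k, w = k *: u) -> d = 0.
Proof.
move=> uN0 u0 uniq_zero; apply/eqP; apply: contraT => dN0.
have [v0 [v1 uv]] : exists v0 v1, u 0 0 * v1 - u 0 1 * v0 != 0.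
  have [u00|u0N] := eqVneq (u 0 0) 0; last by exists 0, 1; rewrite mulr0 mulr1 subr0.
  exists 1, 0; rewrite u00 mul0r sub0r mulr1 oppr_eq0.
  by apply: contraNneq uN0 => u01; rewrite [u]vec_coord u00 u01 vec_eq0 eqxx.
pose t := phi (vec v0 v1) / (d * (u 0 0 * v1 - u 0 1 * v0)).
have td : t * d * (u 0 0 * v1 - u 0 1 * v0) = phi (vec v0 v1).
  by rewrite -mulrA mulfVK // mulf_neq0.
pose w := vec (v0 + t * u 0 0) (v1 + t * u 0 1).
have wu k : w <> k *: u.
  rewrite [u]vec_coord vecZ => /vec_inj[e0 e1]; case/eqP: uv.
  have -> : v0 = (k - t) * u 0 0 by rewrite mulrBl -e0 addrK.
  have -> : v1 = (k - t) * u 0 1 by rewrite mulrBl -e1 addrK.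
  by ring.
have wN0 : w != 0 by apply/eqP=> w0; apply: (wu 0); rewrite scale0r.
have [|k /wu//] := uniq_zero w wN0.
have -> : phi w = phi (vec v0 v1) + t * d * (u 0 0 * v1 - u 0 1 * v0) + t ^+ 2 * phi u +
    (1 + 1) * (a * v0 * t * u 0 0 + b * v1 * t * u 0 1 + d * t * v0 * u 0 1).
  by rewrite /phi !vecE; ring.
by rewrite td u0 add11_eq0 mulr0 mul0r !addr0 -[phi _]mul1r -mulrDl add11_eq0 mul0r.
Qed.

(** The normal form A^2 + B + c of a parabola, with A = (al, be) and B = (e, f).
    Were A and B proportional, the affine point p would make the equation
    split over F, and not only over a quadratic extension. *)
Lemma parabola_affine (K : {set point F}) (I N : point F) (p : 'rV[F]_2) :
  parabola K I -> nucleus K N -> aff p \in K ->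
  exists al be e f c : F,
  [/\ al * f - be * e != 0,
      forall x, (aff x \in K) = (lin_form al be x ^+ 2 + lin_form e f x + c == 0),
      forall d, d != 0 -> (ptinf d == I) = (lin_form al be d == 0)
    & forall d, d != 0 -> (ptinf d == N) = (lin_form e f d == 0)].
Proof.
case=> /conic_coords[a [b [c [d [e [f [Kmem irr]]]]]]] KI nucl pK.
have Iinf : I \in K :&: linf F by rewrite KI set11.
have Kinf u : u != 0 -> (ptinf u \in K) = (a * u 0 0 ^+ 2 + b * u 0 1 ^+ 2 + d * (u 0
  0 * u 0 1) == 0).
  move=> uN0; rewrite Kmem ?row_inf_neq0 //; have [-> -> ->] := row3E u 0.
  by rewrite mxE; congr (_ == 0); ring.
have KinfI u : u != 0 -> (ptinf u \in K) = (ptinf u == I).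
  by move=> uN0; rewrite -in_set1 -KI inE ptinf_linf // andbT.
have [u uN0 eI] : exists2 u, u != 0 & I = ptinf u.
  have [//|[x eI]] := point_cases I.
  by move: Iinf; rewrite eI inE (negPf (aff_linf _)) andbF.
have u0 : a * u 0 0 ^+ 2 + b * u 0 1 ^+ 2 + d * (u 0 0 * u 0 1) = 0.
  by apply/eqP; rewrite -Kinf // KinfI // eI.
have d0 : d = 0.
  apply: (cross_coef_eq0 uN0 u0) => w wN0 /eqP; rewrite -Kinf // KinfI // eI.
  by move=> /eqP/(ptinf_inj wN0 uN0)[k _ ->]; exists k.
subst d; have [al ea] := sqrt_exists a; have [be eb] := sqrt_exists b.
have sqlf x : lin_form al be x ^+ 2 = a * x 0 0 ^+ 2 + b * x 0 1 ^+ 2.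
  rewrite -ea -eb /lin_form.
  have -> : (al * x 0 0 + be * x 0 1) ^+ 2 = al ^+ 2 * x 0 0 ^+ 2 + be ^+ 2 * x 0 1 ^+ 2
     + (1 + 1) * (al * be * x 0 0 * x 0 1) by ring.
  by rewrite add11_eq0 mul0r addr0.
have Kaff x : (aff x \in K) = (lin_form al be x ^+ 2 + lin_form e f x + c == 0).
  rewrite Kmem ?row_aff_neq0 //; have [-> -> ->] := row3E x 1%:M.
  by rewrite mxE eqxx mulr1n sqlf /lin_form; congr (_ == 0); ring.
(* If B = k A, then with s = A(p) the form is (A + s z)(A + (s + k) z); if A = 0,
   it is divisible by z. *)
have det : al * f - be * e != 0.
  apply/eqP=> /subr0_eq afbe.
  have [al0|[k [ek fk]]] : (al = 0 /\ be = 0) \/ exists k, e = k * al /\ f = k * be.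
    have [al0|alN0] := eqVneq al 0; last first.
      right; exists (e / al); rewrite mulfVK //; split=> //.
      by rewrite mulrAC [e * be]mulrC -afbe mulrAC mulfV ?mul1r.
    have [be0|beN0] := eqVneq be 0; first by left.
    right; exists (f / be); rewrite mulfVK //; split=> //.
    by rewrite mulrAC [f * al]mulrC afbe mulrAC mulfV ?mul1r.
  - case: al0 => al0 be0; apply: (irr 0 0 1 e f c);
    rewrite ?(mul0r, mul1r, add0r, addr0) //.
      by rewrite -ea al0 expr0n.
    by rewrite -eb be0 expr0n.
  pose s := lin_form al be p.
  have cs : c = s * (s + k).
    have : s ^+ 2 + k * s + c = 0.
      move: pK; rewrite Kaff /lin_form ek fk => /eqP <-; rewrite /s /lin_form; ring.
    move/eqP; rewrite addrC addr_eq0 => /eqP ->.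
    rewrite -[LHS]addr0 -(mul0r (s * (s + k))) -add11_eq0; ring.
  apply: (irr al be s al be (s + k)) => //.
  - by rewrite [be * _]mulrC -[_ * _]mul1r -mulrDl add11_eq0 mul0r.
  - by rewrite ek -[LHS]addr0 -(mul0r (s * al)) -add11_eq0; ring.
  - by rewrite fk -[LHS]addr0 -(mul0r (s * be)) -add11_eq0; ring.
have ef : (e != 0) || (f != 0).
  by rewrite -negb_and; apply: contraNN det => /andP[/eqP-> /eqP->];
    rewrite !mulr0 subrr.
have Ilf w : w != 0 -> (ptinf w == I) = (lin_form al be w == 0).
  by move=> wN0; rewrite -KinfI // Kinf // mul0r addr0 -sqlf sqrf_eq0.
exists al, be, e, f, c; split=> //.
pose n := vec f (- e).
have nN0 : n != 0 by rewrite vec_eq0 oppr_eq0 negb_and orbC.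
have efn : lin_form e f n = 0 by rewrite /lin_form !vecE; ring.
(* The line through p with direction n, the zero of B, meets K only in p: along it
   B is constant and squaring is injective. *)
have Ntan : N \in affine_line p n.
  apply: nucl; rewrite inE affine_line_in //; apply/cards1P; exists (aff p).
  apply/setP=> P; rewrite in_setI in_set1; apply/andP/eqP=> [[Pl PK]|->]; last first.
    by split=> //; apply/aff_in_affine_line=> //; exists 0; rewrite scale0r addr0.
  have [[w wN0 eP]|[y eP]] := point_cases P.
    move: Pl PK; rewrite eP KinfI // Ilf // => /(ptinf_in_affine_line _ nN0 wN0)[t ew]
      /eqP lw.
    by case/eqP: wN0; apply: indep_forms_ker det lw _; rewrite ew lin_formZ efn mulr0.
  move: Pl PK; rewrite eP => /(aff_in_affine_line _ _ nN0)[t ->].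
  rewrite Kaff !lin_formD !lin_formZ efn mulr0 addr0 => /eqP sq.
  have sqp : lin_form al be p ^+ 2 + lin_form e f p + c = 0 by apply/eqP; rewrite -Kaff.
  have t0 : (t * lin_form al be n) ^+ 2 = 0.
    rewrite -[RHS]sq -[LHS]addr0 -sqp -[LHS]addr0 -(mul0r (t * lin_form al be n *
      lin_form al be p)) -add11_eq0.
    rewrite -[LHS]addr0 -sqp -[X in _ = X]addr0 -sqp; ring.
  move/eqP: t0; rewrite sqrf_eq0 mulf_eq0 => /orP[/eqP->|/eqP ln].
    by rewrite scale0r addr0.
  by case/eqP: nN0; apply: indep_forms_ker det ln efn.
have Ninf : N \in linf F.
  by apply: nucl; rewrite inE linf_in setIC KI cards1.
have [[w wN0 eN]|[y eN]] := point_cases N; last first.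
  by rewrite eN (negPf (aff_linf _)) in Ninf.
move: Ntan; rewrite eN => /(ptinf_in_affine_line _ nN0 wN0)[t ew] v vN0.
have tN0 : t != 0 by apply: contraNneq wN0 => t0; rewrite ew t0 scale0r.
apply/eqP/eqP=> [/(ptinf_inj vN0 wN0)[k _ ->]|/(lin_form_ker ef)[s es]].
  by rewrite ew !lin_formZ efn !mulr0.
rewrite ew ptinf_scale // es ptinf_scale //.
by apply: contraNneq vN0 => s0; rewrite es s0 scale0r.
Qed.

End Parabolas.

(** * New lines through a point of a parabola *)

Section Counting.

Variables (F : finFieldType) (q : nat).
Hypotheses (hq : exists h : nat, q = (2 ^ h)%N) (hF : #|F| = (q ^ 2)%N).
Variable sigma : {rmorphism F -> F}.
Hypothesis sigmaE : sigma =1 (fun x => x ^+ q).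

Local Notation E := (subF F q).
Local Notation ratV := (ratV F q).

Lemma addvv n (x : 'rV[F]_n) : x + x = 0.
Proof. by rewrite -[x]scale1r -scalerDl (add11_eq0 hq hF) scale0r. Qed.

Lemma oppv n (x : 'rV[F]_n) : - x = x.
Proof. by apply/esym/eqP; rewrite -addr_eq0 addvv. Qed.

(** Three elements x, y, z of S produce a fourth one x + y + z. *)
Lemma card_elementary n (S : {set 'rV[F]_n}) : 0 \in S ->
  (forall x y, x \in S -> y \in S -> x + y \in S) -> (#|S| <= 4)%N ->
  [|| #|S| == 1%N, #|S| == 2%N | #|S| == 4%N].
Proof.
move=> S0 SD S4; case: (ltnP 2 #|S|) => [/card_gt2P[x [y [z [[xS yS zS] [xy yz
  zx]]]]]|]; last first.
  have : (0 < #|S|)%N by apply/card_gt0P; exists 0.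
  by move: #|S| => [|[|[|]]].
suff : (4 <= #|S|)%N by move=> h; rewrite [_ == 4%N]eqn_leq S4 h !orbT.
have sub : {subset [:: x; y; z; x + y + z] <= S}.
  by move=> t; rewrite !inE => /or4P[] /eqP-> //; rewrite !SD.
have u : uniq [:: x; y; z; x + y + z].
  have cancel (s t : 'rV[F]_n) : (s == t + s) = (t == 0).
    by rewrite -{1}[s]add0r (inj_eq (addIr s)) eq_sym.
  have neq (s t : 'rV[F]_n) : (s + t == 0) = (s == t) by rewrite addr_eq0 oppv.
  have nx : x != x + y + z by rewrite -addrA [x + _]addrC cancel neq.
  have ny : y != x + y + z by rewrite addrAC cancel neq eq_sym.
  have nz : z != x + y + z by rewrite cancel neq.
  by rewrite /= !inE !negb_or xy yz nx ny nz [x == z]eq_sym zx.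
by rewrite cardE; apply: (uniq_leq_size u) => t /sub; rewrite mem_enum.
Qed.

Variable M : 'M[F]_2.
Hypothesis uM : M \in unitmx.
Variables al be e f c : F.

Local Notation a w := (lin_form al be (w *m M)).
Local Notation b w := (lin_form e f (w *m M)).

Hypothesis aN0 : forall w, w \in ratV -> w != 0 -> a w != 0.

Definition sols (lam : F) : {set 'rV[F]_2} :=
  [set w in ratV | lam * a w ^+ 2 + b w == 0].

Lemma ratVD u v : u \in ratV -> v \in ratV -> u + v \in ratV.
Proof. by rewrite !(ratVP sigmaE) map_mxD => /eqP-> /eqP->. Qed.

Lemma ratVZ t v : t \in E -> v \in ratV -> t *: v \in ratV.
Proof. by rewrite !(ratVP sigmaE) (subF_sigma sigmaE) scale_map => /eqP-> /eqP->. Qed.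

Lemma ratV0 : 0 \in ratV.
Proof. by rewrite (ratVP sigmaE) raddf0. Qed.

Lemma form_aD u v : a (u + v) = a u + a v.
Proof. by rewrite mulmxDl lin_formD. Qed.

Lemma form_a_inj : {in ratV &, injective (fun w => a w)}.
Proof.
move=> u v uR vR /= euv; apply/eqP; rewrite -subr_eq0 oppv.
apply: contraT => /(aN0 (ratVD uR vR)); rewrite form_aD euv -[a v]mul1r -mulrDl.
by rewrite (add11_eq0 hq hF) mul0r eqxx.
Qed.

Lemma sols0 lam : 0 \in sols lam.
Proof. by rewrite inE ratV0 mul0mx /lin_form !mxE !mulr0 !addr0 expr0n mulr0 eqxx. Qed.

Lemma solsD lam u v : u \in sols lam -> v \in sols lam -> u + v \in sols lam.
Proof.
rewrite ![_ \in sols lam]inE => /andP[uR /eqP eu] /andP[vR /eqP ev].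
rewrite ratVD // form_aD mulmxDl lin_formD.
have -> : lam * (a u + a v) ^+ 2 + (b u + b v) =
  (lam * a u ^+ 2 + b u) + (lam * a v ^+ 2 + b v) + (1 + 1) * (lam * a u * a v) by ring.
by rewrite eu ev (add11_eq0 hq hF) mul0r !addr0 eqxx.
Qed.

Lemma lin_form_mulmx al' be' (w : 'rV[F]_2) :
  lin_form al' be' (w *m M) = w 0 0 * lin_form al' be' (vec 1 0 *m M) + w 0 1 *
    lin_form al' be' (vec 0 1 *m M).
Proof.
have -> : w *m M = w 0 0 *: (vec 1 0 *m M) + w 0 1 *: (vec 0 1 *m M).
  rewrite !scalemxAl -mulmxDl vecZ vecD !mulr0 !mulr1 addr0 add0r -vec_coord //.
by rewrite lin_formD !lin_formZ.
Qed.

(** On GF(q)^2 the coordinates of w are fixed by sigma, so A(wM) and its conjugate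
    are two linear forms with coefficients (a1, a2) and (sigma a1, sigma a2).
    They are independent: otherwise a2 / a1 would be rational and A(wM) would have
    a rational zero.  Hence they span the linear forms. *)
Lemma form_b_expansion : exists mu nu, forall w, w \in ratV -> b w = mu * a w + nu *
  sigma (a w).
Proof.
set a1 := a (vec 1 0); set a2 := a (vec 0 1); set b1 := b (vec 1 0);
  set b2 := b (vec 0 1).
have [E0 E1] := subF01 sigmaE.
have a1N0 : a1 != 0 by apply: aN0;
  rewrite ?(ratV_vec sigmaE) ?E0 ?E1 // vec_eq0 oner_eq0.
pose dt := a1 * sigma a2 - a2 * sigma a1.
have dtN0 : dt != 0.
  apply/eqP=> /subr0_eq dt0.
  have rE : a2 / a1 \in E.
    rewrite (subF_sigma sigmaE) fmorph_div; apply/eqP.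
    have sa1 : sigma a1 != 0 by rewrite fmorph_eq0.
    apply: (mulIf sa1); rewrite mulfVK // mulrAC -dt0 mulrAC mulfV ?mul1r //.
  (* The rational zero of A(wM) would be (a2 / a1, -1). *)
  have := aN0 (_ : vec (a2 / a1) (-1) \in ratV).
  rewrite (ratV_vec sigmaE) rE (subF_sigma sigmaE) rmorphN1 eqxx => /(_ isT).
  rewrite vec_eq0 oppr_eq0 oner_eq0 andbF => /(_ isT).
  by rewrite lin_form_mulmx !vecE -/a1 -/a2 mulfVK // mulN1r subrr eqxx.
exists ((b1 * sigma a2 - b2 * sigma a1) / dt), ((a1 * b2 - a2 * b1) / dt) => w.
rewrite (ratVP sigmaE) => /eqP ws;
  rewrite lin_form_mulmx [a w]lin_form_mulmx -/a1 -/a2 -/b1 -/b2.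
have -> : sigma (w 0 0 * a1 + w 0 1 * a2) = w 0 0 * sigma a1 + w 0 1 * sigma a2.
  by rewrite (rmorphD sigma (w 0 0 * a1)) !(rmorphM sigma (w 0 _)) -{3 4}ws !mxE.
by rewrite /dt in dtN0 *; field.
Qed.

(** For z = A(wM) the equation is lam z^2 + mu z + nu sigma(z) = 0.  Applying sigma
    and multiplying by nu^2, one can replace nu sigma(z) by - (lam z^2 + mu z);
    what remains is a polynomial P in z with leading term sigma(lam) lam^2 z^4. *)
Lemma sols_le4 lam : lam != 0 -> (#|sols lam| <= 4)%N.
Proof.
move=> lN0; have [mu [nu bE]] := form_b_expansion.
pose sl := sigma lam.
pose P := Poly [:: 0; sigma nu * nu ^+ 2 - sigma mu * nu * mu;
  sl * mu ^+ 2 - sigma mu * nu * lam;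
   sl * lam * mu *+ 2; sl * lam ^+ 2].
have PN0 : P != 0.
  apply: contraNneq lN0 => /(congr1 (fun P : {poly F} => P`_4));
    rewrite coef_Poly coef0 /= => /eqP.
  by rewrite mulf_eq0 expf_eq0 fmorph_eq0 /= orbb.
have rootP w : w \in sols lam -> root P (a w).
  rewrite inE => /andP[wR]; rewrite (bE _ wR) addrA; move: (a w) => z /eqP hz.
  have zq : nu * sigma z = - (lam * z ^+ 2 + mu * z).
    by apply/eqP; rewrite -addr_eq0 addrC hz.
  have hzs : sl * sigma z ^+ 2 + sigma mu * sigma z + sigma nu * z = 0.
    have ss : sigma (sigma z) = z by rewrite !sigmaE frobK.
    by have := congr1 sigma hz; rewrite rmorph0 !rmorphD !rmorphM ss.
  rewrite rootE horner_Poly /=; apply/eqP.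
  transitivity (nu ^+ 2 * (sl * sigma z ^+ 2 + sigma mu * sigma z + sigma nu * z)).
    have -> : nu ^+ 2 * (sl * sigma z ^+ 2 + sigma mu * sigma z + sigma nu * z) =
      sl * (nu * sigma z) ^+ 2 + sigma mu * nu * (nu * sigma z) + sigma nu * nu ^+ 2 *
        z by ring.
    by rewrite zq; ring.
  by rewrite hzs mulr0.
have := max_poly_roots PN0 (_ : all (root P) [seq a w | w <- enum (sols lam)]).
rewrite size_map -cardE => lt; rewrite -ltnS (leq_trans (lt _ _)) ?size_Poly //.
  by apply/allP=> z /mapP[w]; rewrite mem_enum => /rootP h ->.
rewrite map_inj_in_uniq ?enum_uniq // => u v;
  rewrite !mem_enum => /setIdP[uR _] /setIdP[vR _].
by move=> h; apply: (form_a_inj uR vR h).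
Qed.

Lemma card_sols lam : lam != 0 ->
  [|| #|sols lam| == 1%N, #|sols lam| == 2%N | #|sols lam| == 4%N].
Proof.
move=> lN0; apply: card_elementary (sols_le4 lN0); first exact: sols0.
exact: solsD.
Qed.

Definition scalars i : {set F} := [set lam | (lam != 0) && (#|sols lam| == i)].

Section Conjugate.

Variable kap : F.
Hypothesis kN0 : kap != 0.
Hypothesis bE : forall w, w \in ratV -> b w = kap * sigma (a w).
Hypothesis q2 : (q %% 3 = 2)%N.

Lemma form_a_surj z : exists2 w, w \in ratV & a w = z.
Proof.
have im : (fun w => a w) @: ratV = setT.
  apply/eqP; rewrite eqEcard subsetT /= cardsT hF card_in_imset ?(card_ratV hq hF
    sigmaE) //.
  exact: form_a_inj.
by have : z \in setT by [rewrite inE]; rewrite -im => /imsetP[w wR ->]; exists w.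
Qed.

(** The unit group of F has order q^2 - 1, which is divisible by 3. *)
Lemma cube_root : exists2 ze : F, ze != 1 & ze ^+ 3 = 1.
Proof.
have : (3 %| #|[set: {unit F}]|)%N.
  (* For q = 3 k + 2, q^2 - 1 = 3 (3 k^2 + 4 k + 1). *)
  rewrite card_finField_unit hF; apply/dvdnP;
    exists ((q %/ 3) * (q %/ 3) * 3 + 4 * (q %/ 3) + 1)%N.
  rewrite {1}(divn_eq q 3) q2; lia.
case/Cauchy=> // u _ ou; exists (FinRing.uval u).
  apply/eqP=> u1; have : u = 1%g by apply: val_inj.
  by move/eqP; rewrite -order_eq1 ou.
by rewrite -FinRing.val_unitX -ou expg_order.
Qed.

(** Let ze be a primitive cube root of unity.  As q = 2 modulo 3, it satisfies
    ze^q = ze^2, so z |-> ze z preserves the equation lam z^2 + kap z^q = 0.  A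
    nonzero solution therefore comes with a second one. *)
Lemma sols_not2 lam : lam != 0 -> #|sols lam| != 2%N.
Proof.
move=> lN0; apply/eqP=> s2.
have [w wS wN0] : exists2 w, w \in sols lam & w != 0.
  have : (0 < #|sols lam :\ 0%R|)%N by move: s2;
    rewrite (cardsD1 0) sols0 add1n => -[->].
  by case/card_gt0P=> w /setD1P[]; exists w.
have [ze ze1 ze3] := cube_root; have wS' := wS.
move: wS'; rewrite inE => /andP[wR /eqP]; rewrite bE // => hw.
have [u uR au] := form_a_surj (ze * a w).
have zeN0 : ze != 0 by apply: contra_eq_neq ze3 => ->; rewrite expr0n eq_sym oner_eq0.
have uS : u \in sols lam.
  rewrite inE uR bE // au rmorphM; apply/eqP.
  have -> : sigma ze = ze ^+ 2.
    by rewrite sigmaE (divn_eq q 3) q2 exprD mulnC exprM ze3 expr1n mul1r.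
  by rewrite -[RHS](mulr0 (ze ^+ 2)) -hw; ring.
have uw : u != w.
  apply: contra_neq ze1 => uw; move: au; rewrite uw -{1}[a w]mul1r.
  by move/(mulIf (aN0 wR wN0)).
have uN0 : u != 0.
  apply: contraTneq (mulf_neq0 zeN0 (aN0 wR wN0)) => u0.
  by rewrite -au u0 mul0mx /lin_form !mxE !mulr0 addr0 eqxx.
have : (2 < #|sols lam|)%N.
  by apply/card_gt2P; exists 0, u, w; split; split; rewrite ?sols0 // eq_sym.
by rewrite s2.
Qed.

(** Every nonzero w solves the equation for the single scalar
    lam = - B(wM) / A(wM)^2, and a scalar has either 0 or 3 nonzero solutions. *)
Lemma card_scalars4 : (3 * #|scalars 4| = q ^ 2 - 1)%N.
Proof.
have <- : #|ratV :\ 0%R| = (q ^ 2 - 1)%N.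
  by rewrite -(card_ratV hq hF sigmaE) [in RHS](cardsD1 (0 : 'rV_2)) ratV0 add1n subn1.
pose g w := - b w / a w ^+ 2.
rewrite -[RHS]sum1_card (partition_big g (fun lam => lam != 0)) /=.
  rewrite mulnC -sum_nat_const [LHS]big_mkcond [RHS]big_mkcond /=.
  apply: eq_bigr => lam _; rewrite inE; case: eqP => //= /eqP lN0.
  rewrite sum1dep_card.
  have -> : #|[set w in ratV :\ 0 | g w == lam]| = #|sols lam :\ 0%R|.
    apply: eq_card => w; rewrite [LHS]in_set in_setD1 [RHS]in_setD1 [w \in sols
      lam]in_set -andbA; case: eqP => //= /eqP wN0.
    case wR: (w \in ratV) => //=; have aw := expf_neq0 2 (aN0 wR wN0).
    rewrite /g -(inj_eq (mulIf aw)) mulfVK // eq_sym -addr_eq0 //.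
  have := card_sols lN0; rewrite (negPf (sols_not2 lN0)) (cardsD1 0 (sols lam)) sols0
    add1n /= !eqSS.
  by case/orP=> /eqP->.
move=> w /setD1P[wN0 wR]; rewrite mulf_neq0 ?invr_eq0 ?expf_neq0 ?aN0 // oppr_eq0.
by rewrite bE // mulf_neq0 // fmorph_eq0 aN0.
Qed.

Lemma card_scalars14 : (#|scalars 1| + #|scalars 4| = q ^ 2 - 1)%N.
Proof.
have -> : (q ^ 2 - 1)%N = #|[set~ 0 : F]| by rewrite cardsC1 hF subn1.
rewrite -(cardsID (scalars 1) [set~ 0]); congr (_ + _)%N; apply: eq_card => lam;
  rewrite !inE.
  by case: eqP => //=; rewrite ?andbT // andbF.
case: eqP => //= /eqP lN0; rewrite ?andbT //.
have := card_sols lN0; rewrite (negPf (sols_not2 lN0)) /=.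
by case: eqP => [->|].
Qed.

End Conjugate.

Variables (K : {set point F}) (p : 'rV[F]_2).
Hypothesis Kaff : forall x, (aff x \in K) = (lin_form al be x ^+ 2 + lin_form e f x +
  c == 0).
Hypothesis pK : aff p \in K.

(** Substituting p + lam wM into A^2 + B + c and using that p lies on K leaves
    lam (lam A(wM)^2 + B(wM)), because the cross term vanishes in
    characteristic 2. *)
Lemma new_lineI lam : lam != 0 -> #|new_line q M p lam :&: K| = #|sols lam|.
Proof.
move=> lN0.
have inj : injective (fun w => aff (p + lam *: (w *m M))).
  move=> u v /aff_inj/addrI/(scalerI lN0) h.
  by rewrite -[u](mulmxK uM) h mulmxK.
rewrite -(card_imset _ inj); apply: eq_card => P.
have key w : (aff (p + lam *: (w *m M)) \in K) = (lam * a w ^+ 2 + b w == 0).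
  rewrite Kaff !lin_formD !lin_formZ; move: pK; rewrite Kaff => /eqP h.
  have -> : (lin_form al be p + lam * a w) ^+ 2 + (lin_form e f p + lam * b w) + c =
    lam * (lam * a w ^+ 2 + b w) + (lin_form al be p ^+ 2 + lin_form e f p + c)
    + (1 + 1) * (lin_form al be p * lam * a w) by ring.
  by rewrite h (add11_eq0 hq hF) mul0r !addr0 mulf_eq0 (negPf lN0).
apply/setIP/imsetP=> [[/imsetP[w wR ->]]|[w]].
  by rewrite key => h; exists w; rewrite // inE wR.
rewrite inE -key => /andP[wR wK] ->; split=> //.
by apply/imsetP; exists w.
Qed.

Lemma mem_new_line lam : aff p \in new_line q M p lam.
Proof. by apply/imsetP; exists 0; rewrite ?ratV0 // mul0mx scaler0 addr0. Qed.

(** Compare the points with w = (1, 0) for one direction; for the other, GF(q)^2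
    is stable under multiplication by GF(q). *)
Lemma new_line_eq lam lam' : lam != 0 -> lam' != 0 ->
  (new_line q M p lam' == new_line q M p lam) = (lam' / lam \in E).
Proof.
move=> lN0 lN0'; have [E0 E1] := subF01 sigmaE.
have sub r s : r != 0 -> s / r \in E -> new_line q M p s \subset new_line q M p r.
  move=> rN0 sr; apply/subsetP=> P /imsetP[w wR ->]; apply/imsetP.
  exists ((s / r) *: w); first exact: ratVZ.
  by rewrite -scalemxAl scalerA mulrCA mulfV ?mulr1.
apply/eqP/idP=> [eL|lE].
  have : aff (p + lam' *: (vec 1 0 *m M)) \in new_line q M p lam.
    by rewrite -eL; apply/imsetP; exists (vec 1 0); rewrite // (ratV_vec sigmaE) E0 E1.
  case/imsetP=> w wR /aff_inj/addrI;
    rewrite !scalemxAl => /(congr1 (mulmx^~ (invmx M))).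
  rewrite !mulmxK // [w]vec_coord !vecZ mulr1 => /vec_inj[-> _].
  by move: wR; rewrite [w]vec_coord (ratV_vec sigmaE) !vecE mulrAC mulfV // mul1r =>
    /andP[].
apply/eqP; rewrite eqEsubset !sub //.
by move: lE; rewrite !(subF_sigma sigmaE) !fmorph_div => /eqP h;
  rewrite -[lam / lam']invf_div -h invf_div.
Qed.

Lemma secants_through i :
  [set L in new_lines q (subline_of q M) | (aff p \in L) && secant i K L]
  = [set new_line q M p lam | lam in scalars i].
Proof.
apply/setP=> L; rewrite inE; apply/and3P/imsetP=> [[LN pL Li]|[lam]].
  have [x [lam [lN0 eL]]] := new_line_of_subplane hq hF sigmaE uM LN.
  move: pL Li; rewrite eL => /(new_line_base sigmaE) ->;
    rewrite /secant new_lineI // => Li.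
  by exists lam; rewrite // inE lN0.
rewrite inE => /andP[lN0 li] ->; split; first exact: new_line_in.
  exact: mem_new_line.
by rewrite /secant new_lineI.
Qed.

(** By [new_line_eq] each line arises from the q - 1 scalars lam t with t a nonzero
    element of GF(q). *)
Lemma card_secants i :
  (#|[set new_line q M p lam | lam in scalars i]| * (q - 1))%N = #|scalars i|.
Proof.
rewrite -[RHS]sum1_card (partition_big_imset (fun lam => new_line q M p lam)) /=.
rewrite -sum_nat_const; apply: eq_bigr => L /imsetP[lam];
  rewrite inE => /andP[lN0 li] ->{L}.
rewrite sum1dep_card.
have <- : #|E :\ 0%R| = (q - 1)%N.
  have := card_subF hq hF; rewrite (cardsD1 (0 : F)) (subF_sigma sigmaE) rmorph0 eqxx.
  by rewrite add1n => {2}<-; rewrite subn1.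
rewrite -(card_imset (E :\ 0) (mulfI lN0)); apply: eq_card => r.
rewrite inE; apply/imsetP/andP=> [[t /setD1P[tN0 tE] ->]|[]].
  have eL : new_line q M p (lam * t) = new_line q M p lam.
    by apply/eqP; rewrite new_line_eq ?mulf_neq0 // mulrAC mulfV // mul1r.
  by rewrite eL eqxx inE mulf_neq0 //= -new_lineI ?mulf_neq0 // eL new_lineI.
rewrite inE => /andP[rN0 _]; rewrite new_line_eq // => rE.
exists (r / lam); last by rewrite mulrCA mulfV ?mulr1.
by rewrite !inE mulf_neq0 ?invr_eq0 //=; rewrite inE in rE.
Qed.

Lemma conjugate_count kap : kap != 0 ->
  (forall w, w \in ratV -> b w = kap * sigma (a w)) -> (q %% 3 = 2)%N ->
  (3 * #|[set L in new_lines q (subline_of q M) | (aff p \in L) && secant 4 K L]| = q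
    + 1)%N /\
  (3 * #|[set L in new_lines q (subline_of q M) | (aff p \in L) && secant 1 K L]| = 2
    * (q + 1))%N.
Proof.
move=> kN0 bE q2; rewrite !secants_through; have q1 := q_gt1 hq hF.
have := card_secants 1; have := card_secants 4.
have := card_scalars4 kN0 bE q2; have := card_scalars14 kN0 bE q2.
move: #|scalars 1| #|scalars 4| #|_ @: scalars 1| #|_ @: scalars 4| => n1 n4 m1 m4.
move=> h1 h2 h4 h3; subst n1 n4.
have h0 : (q ^ 2 - 1 = (q + 1) * (q - 1))%N by rewrite -mulnn; nia.
have e4 : (3 * m4 = q + 1)%N.
  by apply/eqP; rewrite -(eqn_pmul2r (_ : 0 < q - 1)%N) ?subn_gt0 // -h0 -h2; lia.
have e1 : (m1 + m4 = q + 1)%N.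
  by apply/eqP; rewrite -(eqn_pmul2r (_ : 0 < q - 1)%N) ?subn_gt0 // -h0 -h1; lia.
lia.
Qed.

End Counting.

(** * Conjugate points and old lines *)

Section Secants.

Variables (F : finFieldType) (q : nat).
Hypotheses (hq : exists h : nat, q = (2 ^ h)%N) (hF : #|F| = (q ^ 2)%N).
Variable sigma : {rmorphism F -> F}.
Hypothesis sigmaE : sigma =1 (fun x => x ^+ q).

(** The form B(xM) vanishes at sigma(w), and so does the form whose coefficients
    are the conjugates of those of A(xM), because A(xM) vanishes at w.  Two forms
    on F^2 with a common zero are proportional, and on rational x the second one
    is sigma(A(xM)). *)
Lemma conjugate_form (M : 'M[F]_2) (al be e f : F) (w : 'rV[F]_2) : M \in unitmx ->
  (forall w, w \in ratV F q -> w != 0 -> lin_form al be (w *m M) != 0) ->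
  al * f - be * e != 0 -> w != 0 ->
  lin_form al be (w *m M) = 0 -> lin_form e f (map_mx sigma w *m M) = 0 ->
  exists2 kap, kap != 0 &
    forall x, x \in ratV F q -> lin_form e f (x *m M) = kap * sigma (lin_form al be (x
      *m M)).
Proof.
move=> uM aN0 det wN0 aw bw.
have [E0 E1] := subF01 sigmaE.
set a1 := lin_form al be (vec 1 0 *m M); set a2 := lin_form al be (vec 0 1 *m M).
set b1 := lin_form e f (vec 1 0 *m M); set b2 := lin_form e f (vec 0 1 *m M).
have a1N0 : a1 != 0 by apply: aN0;
  rewrite ?(ratV_vec sigmaE) ?E0 ?E1 // vec_eq0 oner_eq0.
have sa1 : sigma a1 != 0 by rewrite fmorph_eq0.
have dt : sigma a1 * b2 - sigma a2 * b1 = 0.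
  apply/eqP; apply: contraT => dtN0.
  have : map_mx sigma w = 0.
    apply: indep_forms_ker dtN0 _ _.
      by have := congr1 sigma aw; rewrite lin_form_mulmx -/a1 -/a2 rmorph0 (rmorphD
        sigma (_ * a1)) !(rmorphM sigma (w 0 _)) /lin_form !mxE ![sigma (w _ _) *
          _]mulrC.
    by move: bw; rewrite lin_form_mulmx -/b1 -/b2 /lin_form ![_ * b1]mulrC ![_ *
      b2]mulrC.
  by move/eqP; rewrite map_mx_eq0 (negPf wN0).
have eb2 : b2 = b1 / sigma a1 * sigma a2.
  by apply: (mulfI sa1); rewrite (subr0_eq dt) mulrA [_ * (b1 / _)]mulrC mulfVK //
    mulrC.
exists (b1 / sigma a1) => [|x].
  apply: contraNneq wN0 => k0; rewrite -(mulmx_unit_eq0 _ uM); apply/eqP.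
  apply: indep_forms_ker det aw _;
    rewrite lin_form_mulmx -/b1 -/b2 eb2 k0 mul0r mulr0 addr0.
  by move/eqP: k0; rewrite mulf_eq0 invr_eq0 (negPf sa1) orbF => /eqP->; rewrite mulr0.
rewrite (ratVP sigmaE) => /eqP xs;
  rewrite [LHS]lin_form_mulmx -/b1 -/b2 eb2 lin_form_mulmx -/a1 -/a2.
have -> : sigma (x 0 0 * a1 + x 0 1 * a2) = x 0 0 * sigma a1 + x 0 1 * sigma a2.
  by rewrite (rmorphD sigma (x 0 0 * a1)) !(rmorphM sigma (x 0 _)) -{3 4}xs !mxE.
by field.
Qed.

(** On the line p + t d the equation becomes t (t A(d)^2 + B(d)) = 0. *)
Lemma old_line_secant (l K : {set point F}) (al be e f c : F) (p : 'rV[F]_2) :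
  l \in lines F -> al * f - be * e != 0 ->
  (forall x, (aff x \in K) = (lin_form al be x ^+ 2 + lin_form e f x + c == 0)) ->
  aff p \in K -> aff p \in l ->
  (#|(l :\: linf F) :&: K| <= 2)%N.
Proof.
case/imsetP=> m; rewrite inE => mN0 -> det Kaff pK.
have [a [c0 em]] := line_split m; rewrite em aff_in_line => /eqP pl.
have aN0 : a != 0.
  apply: contraNneq mN0 => a0; move: pl; rewrite em a0 mulmx0 add0r => ->.
  by rewrite -[X in _ == X](@col_mx0 _ 2 1 1).
pose d := vec (a 1 0) (- a 0 0).
have dN0 : d != 0.
  rewrite vec_eq0 oppr_eq0; apply: contra aN0 => /andP[/eqP a1 /eqP a0].
  apply/eqP/colP=> i; rewrite mxE; case: (unliftP 0 i) => [j ->|-> //].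
  by rewrite ord1 -[RHS]a1; congr (a _ _); apply: val_inj.
have da : d *m a = 0.
  rewrite [_ *m _]mx11_scalar mxE big_ord_recl big_ord1.
  have -> : lift ord0 ord0 = 1 :> 'I_2 by apply: val_inj.
  by rewrite !vecE mulNr mulrC subrr raddf0.
(* If A(d) = 0, then t0 = 0 and both points coincide. *)
pose t0 := - (lin_form e f d / lin_form al be d ^+ 2).
have sub : (line (col_mx a c0) :\: linf F) :&: K \subset [set aff p; aff (p + t0 *: d)].
  rewrite affine_part; apply/subsetP=> P /setIP[/imsetP[y + ->]]; rewrite inE.
  rewrite aff_in_line => /eqP yl yK.
  have [t ey] : exists t, y - p = t *: d.
    apply: (ker_line (X := a)) => //; first by rewrite rank_col.
    by rewrite mulmxBl -[p *m a](addrK c0) -[y *m a](addrK c0) yl pl subrr.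
  have {}ey : y = p + t *: d by rewrite -ey addrC subrK.
  have : t * (t * lin_form al be d ^+ 2 + lin_form e f d) = 0.
    move: yK pK; rewrite !Kaff ey !lin_formD !lin_formZ => /eqP h1 /eqP h2.
    rewrite -[RHS](subrr 0) -{1}h1 -h2.
    rewrite -[LHS]addr0 -(mul0r (lin_form al be p * t * lin_form al be d)) -(add11_eq0
      hq hF).
    by ring.
  move/eqP; rewrite mulf_eq0 ey !inE => /orP[/eqP->|/eqP h].
    by rewrite scale0r addr0 eqxx.
  have aN0' : lin_form al be d != 0.
    apply: contraNneq dN0 => ad0; apply/eqP; apply: (indep_forms_ker det ad0).
    by move: h; rewrite ad0 expr0n mulr0 add0r.
  suff -> : t = t0 by rewrite eqxx orbT.
  apply: (mulIf (expf_neq0 2 aN0')); rewrite /t0 mulNr mulfVK ?expf_neq0 //.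
  by apply/eqP; rewrite -addr_eq0 h.
by rewrite (leq_trans (subset_leq_card sub)) // cards2; case: (_ != _).
Qed.

End Secants.

Theorem theorem6p7 (F : finFieldType) (q : nat)
    (hq : exists h : nat, q = (2 ^ h)%N) (hq4 : (4 <= q)%N)
    (hF : #|F| = (q ^ 2)%N)
    (D : {set point F}) (hD : derivation_set q D)
    (K : {set point F}) (I N : point F)
    (hK : parabola K I) (hN : nucleus K N)
    (hID : I \notin D) (hND : N \notin D) :
  (forall L, L \in hall_lines q D ->
     [|| secant 0 K L, secant 1 K L, secant 2 K L | secant 4 K L])
  /\
  (conjugate_pts q D I N -> ~ (exists m : nat, q = (m ^ 2)%N) ->
     (forall P, P \in K :\: linf F ->
        (3 * #|[set L in new_lines q D | (P \in L) && secant 4 K L]|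
           = q + 1)%N /\
        (3 * #|[set L in new_lines q D | (P \in L) && secant 1 K L]|
           = 2 * (q + 1))%N)
     /\
     (forall L, L \in new_lines q D -> ~~ secant 2 K L)).
Proof.
have [sigma sigmaE] := frob_morph hq hF.
have aff_point A P : P \in A :\: linf F -> exists2 p, P = aff p & aff p \in A.
  by rewrite affine_part => /imsetP[p]; rewrite inE => pA ->; exists p.
have IaN0 M al be : M \in unitmx -> D = subline_of q M ->
    (forall d, d != 0 -> (ptinf d == I) = (lin_form al be d == 0)) ->
    forall w, w \in ratV F q -> w != 0 -> lin_form al be (w *m M) != 0.
  move=> uM eD hI w wR wN0; rewrite -hI ?(mulmx_unit_eq0 _ uM) //.
  by apply: contraNneq hID => <-; rewrite eD; apply: mem_subline.
split=> [L|conj nsq].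
  have [|[P /setIP[PL PK]]] := set_0Vmem (L :&: K).
    by rewrite /secant => ->; rewrite cards0.
  have Lpos : (0 < #|L :&: K|)%N by apply/card_gt0P; exists P; rewrite inE PL.
  rewrite inE => /orP[/imsetP[l]|LN].
    rewrite inE => /andP[lL _] eL; move: PL; rewrite eL => /aff_point[p eP pl].
    rewrite eP in PK; have [al [be [e [f [c [det Kaff _ _]]]]]] := parabola_affine hq
      hF hK hN PK.
    have := old_line_secant hq hF lL det Kaff PK pl; rewrite -eL /secant.
    by move: #|_| Lpos => [|[|[|]]].
  have [M uM eD] := hD; rewrite eD in LN.
  have [x [lam [lN0 eL]]] := new_line_of_subplane hq hF sigmaE uM LN.
  have [p _ eP] : exists2 p, true & P = aff p.
    by move: PL; rewrite eL => /imsetP[w _ ->]; eexists.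
  rewrite eP in PK PL; have [al [be [e [f [c [det Kaff hI _]]]]]] := parabola_affine
    hq hF hK hN PK.
  have aN0 := IaN0 _ _ _ uM eD hI.
  move: PL; rewrite eL => /(new_line_base sigmaE) ->.
  rewrite /secant (new_lineI hq hF uM Kaff PK lN0).
  by have /or3P[] := card_sols hq hF sigmaE e f aN0 lN0 => ->; rewrite ?orbT.
case: conj => _ _ [M [uM eD [w [wN0 eI eN]] _]].
have q2 : (q %% 3 = 2)%N by case: hq nsq => h -> /pow2_nonsquare_mod3.
have ews : map_mx (fun x => x ^+ q) w = map_mx sigma w by apply: eq_map_mx => x;
  rewrite sigmaE.
rewrite ews in eN.
have main p : aff p \in K -> exists al be e f c kap,
  [/\ kap != 0, forall x, (aff x \in K) = (lin_form al be x ^+ 2 + lin_form e f x + c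
    == 0),
     forall w, w \in ratV F q -> w != 0 -> lin_form al be (w *m M) != 0 &
    forall x, x \in ratV F q -> lin_form e f (x *m M) = kap * sigma (lin_form al be (x
      *m M))].
  move=> pK; have [al [be [e [f [c [det Kaff hI hN']]]]]] := parabola_affine hq hF hK
    hN pK.
  have aN0 := IaN0 _ _ _ uM eD hI.
  have [||kap kN0 bE] := conjugate_form sigmaE uM aN0 det wN0.
  - by apply/eqP; rewrite -hI ?(mulmx_unit_eq0 _ uM) // eI.
  - by apply/eqP; rewrite -hN' ?(mulmx_unit_eq0 _ uM) ?map_mx_eq0 // eN.
  by exists al, be, e, f, c, kap.
split=> [P /aff_point[p -> pK]|L LN].
  have [al [be [e [f [c [kap [kN0 Kaff aN0 bE]]]]]]] := main p pK.
  by rewrite eD; apply: conjugate_count pK kap kN0 bE q2.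
apply/negP=> s2.
have [P /setIP[PL PK]] : exists P, P \in L :&: K by apply/card_gt0P; rewrite (eqP s2).
rewrite eD in LN; have [x [lam [lN0 eL]]] := new_line_of_subplane hq hF sigmaE uM LN.
have [p _ eP] : exists2 p, true & P = aff p.
  by move: PL; rewrite eL => /imsetP[u _ ->]; eexists.
rewrite eP in PK PL; have [al [be [e [f [c [kap [kN0 Kaff aN0 bE]]]]]]] := main p PK.
move: s2; rewrite /secant eL; move: PL; rewrite eL => /(new_line_base sigmaE) ->.
rewrite (new_lineI hq hF uM Kaff PK lN0).
by apply/negP; apply: (sols_not2 hq hF sigmaE uM aN0 kN0 bE q2 lN0).
Qed.
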